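(* Define the power series $$f_1(q)=\sum_{n\ge0}\frac{q^{\frac{n^2+n}{2}}(q)_{2n}}{(-q)_n(q)_{2n+1}},\quad f_2(q)=\sum_{n\ge1}\frac{q^{\frac{n^2+n}{2}}(q)_{2n-2}}{(-q)_{n-1}(q)_{2n-1}},\quad f_3(q)=\sum_{n\ge0}\frac{(q)_{2n}}{(-q)_{2n+1}}q^n,$$ $$f_4(q)=\sum_{n\ge0}\frac{(q)_{2n+1}}{(-q)_{2n+2}}q^{n+1},\quad f_5(q)=\sum_{n\ge0}(-1)^n\frac{(q)_n}{(q;q^2)_{n+1}}q^{\frac{n^2+n}{2}},\quad f_6(q)=\sum_{n\ge1}(-1)^n\frac{(q)_{n-1}(q^2;q^2)_{n-1}}{(q)_{2n-1}}q^n,$$ $$f_7(q)=\sum_{n\ge0}(-1)^n\frac{q^{n^2+n}(q^2;q^2)_n}{(-q)_{2n+1}},\quad f_8(q)=\sum_{n\ge1}\frac{(q)_{2n-1}}{(q^{2n};q^2)_n}q^n.$$ For $1\le i\le 8$ let $a_{f_i}(n)$ denote the coefficient of $q^n$ in $f_i$ and let $$S_i:=\{m\in\mathbb{Z}:\ \text{there are infinitely many } n \text{ such that } a_{f_i}(n)=m\}.$$ Then $$S_i=\begin{cases}\mathbb{N}_0 & \text{if } i\in\{1,2,5\},\\ -\mathbb{N}_0 & \text{if } i=6,\\ \mathbb{Z} & \text{if } i\in\{4,7\},\\ \mathbb{N}_0\cup(-2\mathbb{N}) & \text{if } i\in\{3,8\}.\end{cases}$$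
   Context: The $f_i$ are regarded as formal power series in $q$. Notation: $(a;q)_n:=\prod_{j=0}^{n-1}(1-aq^j)$ and $(a)_n:=(a;q)_n$; a second argument $q^2$ means $q$ is replaced by $q^2$ in this definition, i.e. $(a;q^2)_n=\prod_{j=0}^{n-1}(1-aq^{2j})$. $\mathbb{N}=\{1,2,3,\dots\}$, $\mathbb{N}_0=\mathbb{N}\cup\{0\}$, $-\mathbb{N}_0=\{-m: m\in\mathbb{N}_0\}$ and $-2\mathbb{N}=\{-2m: m\in\mathbb{N}\}$. *)

(* Defs.v *)
From mathcomp Require Import all_boot all_order all_algebra.
From mathcomp Require Import boolp classical_sets functions cardinality fsbigop.

Set Implicit Arguments.
Unset Strict Implicit.
Unset Printing Implicit Defensive.

Import Order.TTheory GRing.Theory Num.Theory.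
Local Open Scope classical_set_scope.
Local Open Scope ring_scope.

(* A formal power series in q, given by its coefficients; the variable q is
   'X in the polynomials {poly int} below. *)
Definition fps := nat -> int.

(* (a; Q)_n, for polynomials a and Q in q *)
Definition qpoch (a Q : {poly int}) (n : nat) : {poly int} :=
  \prod_(j < n) (1 - a * Q ^+ j).

(* The power series N / D, for D(0) = 1, expanded as
   \sum_j N * (1 - D)^j: as 1 - D has no constant term, only the indices
   j <= k contribute to the coefficient of q^k. It is characterized by
   fps_divP and fps_div_uniq. *)
Definition fps_div (N D : {poly int}) : fps :=
  fun k => \sum_(j < k.+1) (N * (1 - D) ^+ j)`_k.

(* \sum_(n >= m) F n, for families such that each power of q occurs in finitely
   many F n. *)
Definition fps_sum (m : nat) (F : nat -> fps) : fps :=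
  fun k => \sum_(n \in [set n | (m <= n)%N]) F n k.

Section Terms.
Local Notation q := ('X : {poly int}).

Definition t1 (n : nat) : fps :=
  fps_div (q ^+ ((n ^ 2 + n) %/ 2) * qpoch q q (2 * n))
          (qpoch (- q) q n * qpoch q q (2 * n + 1)).

Definition t2 (n : nat) : fps :=
  fps_div (q ^+ ((n ^ 2 + n) %/ 2) * qpoch q q (2 * n - 2))
          (qpoch (- q) q (n - 1) * qpoch q q (2 * n - 1)).

Definition t3 (n : nat) : fps :=
  fps_div (qpoch q q (2 * n) * q ^+ n) (qpoch (- q) q (2 * n + 1)).

Definition t4 (n : nat) : fps :=
  fps_div (qpoch q q (2 * n + 1) * q ^+ (n + 1)) (qpoch (- q) q (2 * n + 2)).

Definition t5 (n : nat) : fps :=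
  fps_div ((- 1) ^+ n * qpoch q q n * q ^+ ((n ^ 2 + n) %/ 2))
          (qpoch q (q ^+ 2) (n + 1)).

Definition t6 (n : nat) : fps :=
  fps_div ((- 1) ^+ n * (qpoch q q (n - 1) * qpoch (q ^+ 2) (q ^+ 2) (n - 1))
             * q ^+ n)
          (qpoch q q (2 * n - 1)).

Definition t7 (n : nat) : fps :=
  fps_div ((- 1) ^+ n * (q ^+ (n ^ 2 + n) * qpoch (q ^+ 2) (q ^+ 2) n))
          (qpoch (- q) q (2 * n + 1)).

Definition t8 (n : nat) : fps :=
  fps_div (qpoch q q (2 * n - 1) * q ^+ n)
          (qpoch (q ^+ (2 * n)) (q ^+ 2) n).

End Terms.

Definition f1 : fps := fps_sum 0 t1.
Definition f2 : fps := fps_sum 1 t2.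
Definition f3 : fps := fps_sum 0 t3.
Definition f4 : fps := fps_sum 0 t4.
Definition f5 : fps := fps_sum 0 t5.
Definition f6 : fps := fps_sum 1 t6.
Definition f7 : fps := fps_sum 0 t7.
Definition f8 : fps := fps_sum 1 t8.

Definition inf_values (f : fps) : set int :=
  [set m | infinite_set [set n : nat | f n = m]].

Definition intN0 : set int := [set n%:Z | n in [set: nat]].
Definition intoppN0 : set int := [set - n%:Z | n in [set: nat]].
Definition intopp2N : set int := [set - (2 * n)%:Z | n in [set n | (1 <= n)%N]].

(* The quotients and the infinite sums above are the intended ones: the
   denominators have constant term 1, and the n-th term has order >= n. *)

Lemma coef_low_mul (p r : {poly int}) (a b : nat) :
  (forall i, (i < a)%N -> p`_i = 0) -> (forall i, (i < b)%N -> r`_i = 0) ->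
  forall i, (i < a + b)%N -> (p * r)`_i = 0.
Proof.
move=> pa rb i iab; rewrite coefM big1 // => j _.
have [ja|aj] := ltnP j a; first by rewrite pa // mul0r.
rewrite rb ?mulr0 // ltn_subLR; last by rewrite -ltnS ltn_ord.
by apply: (leq_trans iab); rewrite leq_add2r.
Qed.

Lemma coef_low_exp (p : {poly int}) (j : nat) :
  p`_0 = 0 -> forall i, (i < j)%N -> (p ^+ j)`_i = 0.
Proof.
move=> p0; elim: j => [|j IH] i // ij.
rewrite exprS; apply: (@coef_low_mul _ _ 1 j) => //; by case.
Qed.

Lemma fps_div_trunc (N D : {poly int}) (k M : nat) :
  D`_0 = 1 -> (k < M)%N -> fps_div N D k = (\sum_(j < M) N * (1 - D) ^+ j)`_k.
Proof.
move=> D0 kM; rewrite coef_sum /fps_div.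
rewrite -(big_mkord xpredT (fun j => (N * (1 - D) ^+ j)`_k)).
rewrite -(big_mkord xpredT (fun j => (N * (1 - D) ^+ j)`_k)).
rewrite (big_cat_nat (n := k.+1) _ (p := M)) //=.
have -> : \sum_(k.+1 <= j < M) (N * (1 - D) ^+ j)`_k = 0; last by rewrite addr0.
rewrite big_nat_cond big1 // => j /andP[/andP[kj _] _]; apply: (@coef_low_mul _ _ 0 j) => //.
by apply: coef_low_exp; rewrite coefB coef1 D0 subrr.
Qed.

Lemma fps_divP (N D : {poly int}) (k : nat) : D`_0 = 1 ->
  \sum_(i < k.+1) D`_i * fps_div N D (k - i)%N = N`_k.
Proof.
move=> D0.
rewrite (eq_bigr (fun i : 'I_k.+1 =>
    D`_i * (\sum_(j < k.+1) N * (1 - D) ^+ j)`_(k - i)%N)); last first.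
  by move=> i _; rewrite -(@fps_div_trunc N D (k - i)%N) // ltnS leq_subr.
rewrite -coefM -mulr_sumr mulrCA.
have -> : D * (\sum_(j < k.+1) (1 - D) ^+ j) = 1 - (1 - D) ^+ k.+1.
  by rewrite -[RHS]opprB subrX1 -mulNr opprB subKr.
rewrite mulrBr mulr1 coefB [X in _ - X](@coef_low_mul _ _ 0 k.+1) ?subr0 //.
by apply: coef_low_exp; rewrite coefB coef1 D0 subrr.
Qed.

Lemma fps_div_uniq (N D : {poly int}) (c : fps) : D`_0 = 1 ->
  (forall k, \sum_(i < k.+1) D`_i * c (k - i)%N = N`_k) ->
  forall k, c k = fps_div N D k.
Proof.
move=> D0 cE k; elim/ltn_ind: k => k IH.
have := cE k; rewrite -(fps_divP N k D0) !big_ord_recl /= D0 !mul1r subn0.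
rewrite [in X in _ = X -> _](eq_bigr
  (fun i : 'I_k => D`_(bump 0 i) * c (k - bump 0 i)%N)).
  by move/addIr.
move=> i _; rewrite IH // /bump /= add1n ltn_subrL /=.
by apply: leq_ltn_trans (ltn_ord i).
Qed.

Lemma fps_sum_trunc (m : nat) (F : nat -> fps) (k M : nat) :
  (forall n, (m <= n)%N -> (k < n)%N -> F n k = 0) -> (k < M)%N ->
  fps_sum m F k = \sum_(m <= n < M) F n k.
Proof.
move=> F0 kM; rewrite /fps_sum [RHS]fsbig_seq; last exact: iota_uniq.
apply/esym/fsbig_widen => n /=.
  by rewrite mem_index_iota => /andP[].
case=> mn; rewrite mem_index_iota mn /= => /negP; rewrite -leqNgt => Mn.
by apply: F0 => //; apply: leq_trans Mn.
Qed.

Lemma fps_div_low (N D : {poly int}) (a k : nat) :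
  (forall i, (i < a)%N -> N`_i = 0) -> (k < a)%N -> fps_div N D k = 0.
Proof.
move=> Na ka; rewrite /fps_div big1 // => j _.
by apply: (@coef_low_mul _ _ a 0) => //; rewrite addn0.
Qed.

Lemma coef_lowXn (p : {poly int}) (a b i : nat) :
  (b <= a)%N -> (i < b)%N -> (p * 'X^a)`_i = 0.
Proof. by move=> ba ib; rewrite coefMXn (leq_trans ib ba). Qed.

Lemma terms_low (n k : nat) : (k < n)%N ->
  [/\ t1 n k = 0, t2 n k = 0, t3 n k = 0 & t4 n k = 0] /\
  [/\ t5 n k = 0, t6 n k = 0, t7 n k = 0 & t8 n k = 0].
Proof.
move=> kn.
have tri : (n <= (n ^ 2 + n) %/ 2)%N.
  rewrite leq_divRL // muln2 -addnn leq_add2r.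
  by case: (n) => // m; rewrite -mulnn leq_pmulr.
have sq : (n <= n ^ 2 + n)%N by exact: leq_addl.
have n1 : (n <= n + 1)%N by exact: leq_addr.
split; split; apply: (@fps_div_low _ _ n) => // i ni.
- by rewrite mulrC; exact: coef_lowXn tri ni.
- by rewrite mulrC; exact: coef_lowXn tri ni.
- exact: coef_lowXn (leqnn n) ni.
- exact: coef_lowXn n1 ni.
- exact: coef_lowXn tri ni.
- exact: coef_lowXn (leqnn n) ni.
- by rewrite ['X^_ * _]mulrC mulrA; exact: coef_lowXn sq ni.
- exact: coef_lowXn (leqnn n) ni.
Qed.

Lemma qpoch_coef0 (a Q : {poly int}) (n : nat) :
  a`_0 = 0 -> (qpoch a Q n)`_0 = 1.
Proof.
move=> a0; rewrite -horner_coef0 /qpoch horner_prod big1 // => j _.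
by rewrite !hornerE (horner_coef0 a) a0 mul0r subr0.
Qed.

Lemma denominators_coef0 (n : nat) :
  [/\ (qpoch (- 'X) 'X n * qpoch 'X 'X (2 * n + 1))`_0 = 1,
      (qpoch (- 'X) 'X (n - 1) * qpoch 'X 'X (2 * n - 1))`_0 = 1,
      (qpoch (- 'X) 'X (2 * n + 1))`_0 = 1 &
      (qpoch (- 'X) 'X (2 * n + 2))`_0 = 1] /\
  [/\ (qpoch 'X ('X ^+ 2) (n + 1))`_0 = 1,
      (qpoch 'X 'X (2 * n - 1))`_0 = 1 &
      ((1 <= n)%N -> (qpoch ('X ^+ (2 * n)) ('X ^+ 2) n)`_0 = 1)].
Proof.
have X0 : ('X : {poly int})`_0 = 0 by rewrite coefX.
have NX0 : (- 'X : {poly int})`_0 = 0 by rewrite coefN coefX oppr0.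
split; split; last by case: n => // n _; rewrite qpoch_coef0 // coefXn.
all: by rewrite ?coef0M ?qpoch_coef0 ?mulr1.
Qed.

(* Main.v *)
Require Import Defs.
From mathcomp Require Import all_boot all_order all_algebra.
From mathcomp Require Import boolp classical_sets functions cardinality fsbigop.
From mathcomp Require Import ring lra zify.

(** For d = 2 or 3 and an integer N, let c_d(N) be the number of integer points
    (u, v) on u^2 - d v^2 = N in the cone -u < d v <= u. Multiplication by
    the unit 3 + 2 sqrt 2, resp. 2 + sqrt 3, sends the ray d v = -u to the ray
    d v = u, so the cone is a fundamental domain and c_d(N) counts totally
    positive elements of norm N in Z[sqrt d] up to powers of that unit. The
    theorem holds because every coefficient is such a number, up to a sign that
    depends on the exponent k only:
<<
      f1 :              c_2(16 k + 1)     f5 :              c_3(3 (8 k + 2))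
      f2 :              c_2(16 k - 7)     f6 :            - c_3(3 (4 k - 1))
      f3 : (-1)^k       c_2(2 k + 1)      f7 : (-1)^k       c_3(3 k + 1)
      f4 : (-1)^(k + 1) c_2(2 k)          f8 : (-1)^(k + 1) c_3(2 (3 k - 1))
>>
    The table ([f1_count], ..., [f8_count]) comes from Hecke-type double sums.
    Write a series as the sum over n of delta_n beta_n, where beta_n is the sum
    over r <= n of alpha_r / ((Q;Q)_(n-r) (Q;Q)_(n+r+s)). Interchanging the two
    summations turns it into the sum of alpha_r gamma_r with
    gamma_r = sum over n of delta_n / ((Q;Q)_(n-r) (Q;Q)_(n+r+s)). For
    delta_n = (Q;Q)_n prod_(i < n) (z - Q^(s+i)), gamma_r is a product, a case of
    the q-Gauss sum ([conjugate_estimate], [bailey_lemma]). In each of the five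
    pairs (alpha, beta) in use, alpha_r is a monomial times a partial sum of a
    theta series, and the relation between alpha and beta is proved by
    telescoping twice: in r, where the partial theta sum gets replaced by its
    last term, and then once more ([bailey_pair_telescope]). The single series
    W(x) = f1(x^2) + f2(x^2)/x, whose coefficient at x^m is c_2(8 m + 1),
    yields f1 and f2 together.

    The arithmetic is elementary. If p = pi pi' splits and p does not divide
    N, then c_d(p^k N) = (k + 1) c_d(N) ([prime_power_count]): solutions of norm
    p M divisible by pi correspond to all solutions of norm M, and the others
    to the solutions of norm M not divisible by pi. If q is inert, then
    c_d(q^2 N) = c_d(N), while c_d(N) = 0 when q divides N exactly once.
    Taking p = 17, q = 3 for d = 2 and p = 13, q = 5 for d = 3, with a suitable
    small factor N fixing the residue class and the sign, yields each value of
    the right-hand side infinitely often. Conversely, the signs in the table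
    settle f1, f2, f5 and f6, and for f3 and f8 a negative coefficient is even
    because (u, v) -> (u, -v) is an involution without fixed point on the
    solutions ([counted_even]). *)

Set Implicit Arguments.
Unset Strict Implicit.
Unset Printing Implicit Defensive.

Import Order.TTheory GRing.Theory Num.Theory.
Local Open Scope classical_set_scope.
Local Open Scope ring_scope.

(** * Finite q-identities: Bailey pairs and the conjugate pair *)

Section Finite.
Variable L : fieldType.

Definition poch (a Q : L) (n : nat) : L := \prod_(j < n) (1 - a * Q ^+ j).

Lemma pochS a Q n : poch a Q n.+1 = poch a Q n * (1 - a * Q ^+ n).
Proof. by rewrite /poch big_ord_recr. Qed.

Lemma poch0 a Q : poch a Q 0 = 1.
Proof. by rewrite /poch big_ord0. Qed.

(** The kernel of Bailey's transform, extended by 0 to r > n so that sums over r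
    and over n can be interchanged on a square. Up to the factor (Q;Q)_(2n+s) it
    is the q-binomial coefficient [2n+s; n-r]. *)
Definition weight (Q : L) (s n r : nat) : L :=
  if (r <= n)%N then (poch Q Q (n - r) * poch Q Q (n + r + s))^-1 else 0.

(** Telescoping against a sequence that is itself a partial sum: T obeys a first
    order recursion with inhomogeneity c (a monomial times a partial theta sum,
    c being the last theta term), and g is an antidifference of f adapted to
    that recursion, so the partial sums T disappear and only c is left. *)
Lemma double_telescope (T u c f g : nat -> L) N :
  T 0%N = c 0%N -> (forall r, T r.+1 = u r * T r + c r.+1) ->
  (forall r, (r <= N)%N -> f r = g r - u r * g r.+1) -> g N.+1 = 0 ->
  \sum_(r < N.+1) f r * T r = \sum_(r < N.+1) g r * c r.
Proof.
move=> T0 TS fE gN.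
suff H k : (k <= N)%N ->
    \sum_(r < k.+1) f r * T r = \sum_(r < k.+1) g r * c r - u k * g k.+1 * T k.
  by rewrite H // gN mulr0 mul0r subr0.
elim: k => [|k IH] kN; first by rewrite !big_ord1 fE // T0; ring.
rewrite big_ord_recr /= IH 1?ltnW // fE // [in RHS]big_ord_recr /= TS; ring.
Qed.

(** The variant for partial theta sums that run over one parity class, where
    T_(r+2) is related to T_r. *)
Lemma double_telescope2 (T u c f g : nat -> L) N :
  T 0%N = c 0%N -> T 1%N = c 1%N ->
  (forall r, T r.+2 = u r * T r + c r.+2) ->
  (forall r, (r <= N)%N -> f r = g r - u r * g r.+2) ->
  g N.+1 = 0 -> g N.+2 = 0 ->
  \sum_(r < N.+1) f r * T r = \sum_(r < N.+1) g r * c r.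
Proof.
move=> T0 T1 TS fE gN gN1.
case: N => [|N] in fE gN gN1 *.
  by rewrite !big_ord1 fE // gN1 T0; ring.
suff H k : (k <= N)%N ->
    \sum_(r < k.+2) f r * T r =
    \sum_(r < k.+2) g r * c r - u k * g k.+2 * T k - u k.+1 * g k.+3 * T k.+1.
  by rewrite H // gN gN1; ring.
elim: k => [|k IH] kN.
  by rewrite !big_ord_recr !big_ord0 /= !fE // T0 T1; ring.
rewrite big_ord_recr /= IH 1?ltnW // fE // [in RHS]big_ord_recr /= TS; ring.
Qed.

Lemma telescope_ord (F h : nat -> L) n :
  (forall i, (i < n)%N -> F i = h i - h i.+1) -> \sum_(i < n) F i = h 0%N - h n.
Proof.
elim: n => [|n IH] Fh; first by rewrite big_ord0 subrr.
rewrite big_ord_recr /= IH => [|i ni]; last by rewrite Fh // ltnW.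
by rewrite Fh // addrA subrK.
Qed.

Section Base.
Variable Q : L.
Hypothesis hQ : forall k, 1 - Q ^+ k.+1 != 0.

Lemma poch_neq0 k : poch Q Q k != 0.
Proof.
elim: k => [|k IH]; first by rewrite poch0 oner_neq0.
by rewrite pochS mulf_neq0 // -exprS.
Qed.

Lemma one_add_exp_neq0 k : 1 + Q ^+ k.+1 != 0.
Proof.
have := hQ (k.+1 + k); rewrite -addnS exprD; apply: contraNneq => e.
have -> : 1 - Q ^+ k.+1 * Q ^+ k.+1 = (1 - Q ^+ k.+1) * (1 + Q ^+ k.+1) by ring.
by rewrite e mulr0.
Qed.

(** This rule, the next two and [weight_diag] express all neighbours of a weight as
    rational multiples of one of them; the q-identities then become rational
    identities in Q^r and Q^(n-r). *)
Lemma weight_shift s n r : weight Q s n r = weight Q s.+1 n r * (1 - Q ^+ (n + r + s).+1).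
Proof.
rewrite /weight; case: ifP => _; last by rewrite mul0r.
rewrite addnS pochS -exprS; field.
by rewrite !poch_neq0 hQ.
Qed.

Lemma weight_grow s n r : (r <= n.+1)%N ->
  weight Q s.+1 n r = weight Q s n.+1 r * (1 - Q ^+ (n.+1 - r)).
Proof.
move=> rn; rewrite /weight rn.
have [->|neq] := eqVneq r n.+1; first by rewrite ltnn subnn subrr mulr0.
have rn' : (r <= n)%N by lia.
rewrite rn' subSn // pochS -exprS.
have -> : (n.+1 + r + s = n + r + s.+1)%N by lia.
field; by rewrite !poch_neq0 hQ.
Qed.

Lemma weight_next s n r : (r <= n)%N ->
  weight Q s n r.+1 = weight Q s.+1 n r * (1 - Q ^+ (n - r)).
Proof.
move=> rn; rewrite /weight rn.
have [->|neq] := eqVneq r n; first by rewrite ltnn subnn subrr mulr0.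
have rn' : (r < n)%N by lia.
rewrite rn' -(subnSK rn') pochS -exprS.
have -> : (n + r.+1 + s = n + r + s.+1)%N by lia.
field; by rewrite !poch_neq0 hQ.
Qed.

Lemma weight_gt s n r : (n < r)%N -> weight Q s n r = 0.
Proof. by rewrite /weight ltnNge => /negbTE ->. Qed.

Lemma weight_step s n r : (r <= n)%N ->
  weight Q s n r.+1 * (1 - Q ^+ (n + r + s).+1) = weight Q s n r * (1 - Q ^+ (n - r)).
Proof. by move=> rn; rewrite weight_next // [in RHS]weight_shift mulrAC. Qed.

(** A finite form of sum_(j in Z) (-1)^j Q^(j(j+1)/2) [2M; M-j] = 0, folded to
    r >= 0. Instead of the q-binomial theorem, the terms are differences of
    (-1)^r Q^(r(r-1)/2) [2M-1; M-r], up to a factor free of r. *)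
Lemma alternating_sum_even M : (0 < M)%N ->
  weight Q 0 M 0 + \sum_(r < M) (-1) ^+ r.+1 * (Q ^+ 'C(r.+1, 2) + Q ^+ 'C(r.+2, 2))
     * weight Q 0 M r.+1 = 0.
Proof.
move=> M0; have QM : 1 - Q ^+ M != 0 by rewrite -(prednK M0).
pose h r := (-1) ^+ r * Q ^+ 'C(r, 2) * weight Q 0 M r * (1 - Q ^+ (M + r)) / (1 - Q ^+ M).
have hE r : (r <= M)%N ->
  (-1) ^+ r * (Q ^+ 'C(r, 2) + Q ^+ 'C(r.+1, 2)) * weight Q 0 M r = h r - h r.+1.
  move=> rM; rewrite {}/h -mulrBl; apply: (canRL (mulfK QM)).
  rewrite addnS weight_next // [weight Q 0 M r]weight_shift addn0 binS bin1 exprD !exprS !exprD.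
  have -> : Q ^+ M = Q ^+ (M - r) * Q ^+ r by rewrite -exprD subnK.
  ring.
rewrite (telescope_ord (F := fun r => (-1) ^+ r.+1 * (Q ^+ 'C(r.+1, 2) +
  Q ^+ 'C(r.+2, 2)) * weight Q 0 M r.+1) (h := fun r => h r.+1)); last by move=> i; apply: hE.
rewrite /= [h M.+1]/h [weight Q 0 M M.+1]weight_gt // mulr0 !mul0r subr0 /h addn1 bin_small // expr0 expr1.
have := weight_step 0 (leq0n M); rewrite !addn0 subn0 => wE.
by rewrite mulr1 mulN1r !mulNr wE mulfK // subrr.
Qed.

(** Both sides obey the recursion beta_(n+1) = rho_n beta_n as soon as the
    weights at n+1 and n, combined with the same rho_n, are orthogonal to T. *)
Lemma bailey_pair_ind (s : nat) (T v beta rho : nat -> L) :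
  beta 0%N = v 0%N * T 0%N * weight Q s 0 0 ->
  (forall n, beta n.+1 = rho n * beta n) ->
  (forall n, \sum_(r < n.+2) v r * (weight Q s n.+1 r - rho n * weight Q s n r) * T r = 0) ->
  forall n, \sum_(r < n.+1) v r * T r * weight Q s n r = beta n.
Proof.
move=> b0 bS step; elim=> [|n IH]; first by rewrite big_ord1.
rewrite bS -IH mulr_sumr; apply: subr0_eq; apply: etrans _ (step n).
rewrite [RHS]big_ord_recr /= [weight Q s n n.+1]weight_gt // mulr0 subr0.
rewrite [X in X - _]big_ord_recr /= addrAC -sumrB; congr (_ + _); last by ring.
by apply: eq_bigr => i _; ring.
Qed.

(** The scheme of the Bailey pairs below: g n is a Gosper certificate for the
    step from n to n+1, and what is left after the first telescoping is a single
    sum that vanishes. *)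
Lemma bailey_pair_telescope s (T u c v beta rho : nat -> L) (g : nat -> nat -> L) :
  T 0%N = c 0%N -> (forall r, T r.+1 = u r * T r + c r.+1) ->
  beta 0%N = v 0%N * T 0%N * weight Q s 0 0 ->
  (forall n, beta n.+1 = rho n * beta n) ->
  (forall n r, (r <= n.+1)%N ->
     v r * (weight Q s n.+1 r - rho n * weight Q s n r) = g n r - u r * g n r.+1) ->
  (forall n, g n n.+2 = 0) -> (forall n, \sum_(r < n.+2) g n r * c r = 0) ->
  forall n, \sum_(r < n.+1) v r * T r * weight Q s n r = beta n.
Proof.
move=> T0 TS b0 bS gE g0 gc; apply: (bailey_pair_ind b0 bS) => n; rewrite -[RHS](gc n).
exact: (double_telescope (f := fun r => v r * (weight Q s n.+1 r - rho n * weight Q s n r))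
  T0 TS (gE n) (g0 n)).
Qed.

Lemma bailey_pair_telescope2 s (T u c v beta rho : nat -> L) (g : nat -> nat -> L) :
  T 0%N = c 0%N -> T 1%N = c 1%N -> (forall r, T r.+2 = u r * T r + c r.+2) ->
  beta 0%N = v 0%N * T 0%N * weight Q s 0 0 ->
  (forall n, beta n.+1 = rho n * beta n) ->
  (forall n r, (r <= n.+1)%N ->
     v r * (weight Q s n.+1 r - rho n * weight Q s n r) = g n r - u r * g n r.+2) ->
  (forall n, g n n.+2 = 0) -> (forall n, g n n.+3 = 0) ->
  (forall n, \sum_(r < n.+2) g n r * c r = 0) ->
  forall n, \sum_(r < n.+1) v r * T r * weight Q s n r = beta n.
Proof.
move=> T0 T1 TS b0 bS gE g0 g1 gc; apply: (bailey_pair_ind b0 bS) => n; rewrite -[RHS](gc n).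
exact: (double_telescope2 (f := fun r => v r * (weight Q s n.+1 r - rho n * weight Q s n r))
  T0 T1 TS (gE n) (g0 n) (g1 n)).
Qed.

Lemma alternating_sum_even_scaled (K : L) (G : nat -> L) M : (0 < M)%N ->
  G 0%N = K * weight Q 0 M 0 ->
  (forall r, (r < M)%N -> G r.+1 = K * ((-1) ^+ r.+1 *
     (Q ^+ 'C(r.+1, 2) + Q ^+ 'C(r.+2, 2)) * weight Q 0 M r.+1)) ->
  \sum_(r < M.+1) G r = 0.
Proof.
move=> M0 G0 GS; rewrite big_ord_recl G0.
rewrite (eq_bigr (fun r : 'I_M => K * ((-1) ^+ r.+1 *
     (Q ^+ 'C(r.+1, 2) + Q ^+ 'C(r.+2, 2)) * weight Q 0 M r.+1))) => [|r _]; last exact: GS.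
by rewrite -mulr_sumr -mulrDr alternating_sum_even // mulr0.
Qed.

(** Here T_r = (-1)^r Q^(r^2+r) sum_(|j| <= r) Q^(-j(j+1)/2); only the recursion
    of T matters. The certificate is Q^(n+1-r) [2n+2; n+1-r] up to a factor
    depending on n. *)
Lemma bailey_pair_f5 (T : nat -> L) : Q != 0 -> T 0%N = 1 ->
  (forall r, T r.+1 = - Q ^+ (2 * r + 2) * T r +
     (-1) ^+ r.+1 * (Q ^+ 'C(r.+2, 2) + Q ^+ ('C(r.+2, 2) + r.+1))) ->
  forall n, \sum_(r < n.+1) 1 * T r * weight Q 1 n r = (poch Q (Q ^+ 2) n.+1)^-1.
Proof.
move=> Q0 T0 TS.
have Q1 : 1 - Q != 0 by exact: (hQ 0).
apply: (@bailey_pair_telescope _ _ _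
  (fun r => if r is r'.+1 then
     (-1) ^+ r * (Q ^+ 'C(r.+1, 2) + Q ^+ ('C(r.+1, 2) + r)) else 1)
  (fun=> 1) _ (fun n => (1 - Q * (Q ^+ 2) ^+ n.+1)^-1)
  (fun n r => Q ^+ n.+1 / (1 - Q ^+ (2 * n + 3)) / Q ^+ r * weight Q 0 n.+1 r) T0 TS).
- by rewrite T0 /weight /= !pochS !poch0 !expr0 !mul1r.
- by move=> n; rewrite pochS invfM mulrC.
- move=> n r rn.
  have -> : 1 - Q * (Q ^+ 2) ^+ n.+1 = 1 - Q ^+ (2 * n + 3).
    by rewrite -exprM -exprS; congr (1 - Q ^+ _); lia.
  have K0 : 1 - Q ^+ (2 * n + 3) != 0 by rewrite addn3.
  have W0 : 1 - Q ^+ (n.+1 + r + 1) != 0 by rewrite addn1.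
  have Qr : Q ^+ r != 0 by rewrite expf_neq0.
  rewrite mul1r [weight Q 1 n r]weight_grow // [weight Q 0 n.+1 r.+1]weight_next // [weight Q 0 n.+1 r]weight_shift.
  move: K0; rewrite addn0.
  have -> : (2 * n + 3 = ((n.+1 - r) + r) + ((n.+1 - r) + r) + 1)%N by lia.
  have -> : (n.+1 + r).+1 = ((n.+1 - r) + r + r + 1)%N by lia.
  have -> : (2 * r + 2 = r + r + 2)%N by lia.
  have -> : Q ^+ n.+1 = Q ^+ ((n.+1 - r) + r) by congr (_ ^+ _); lia.
  rewrite !exprS !exprD => K0; field.
  by rewrite Qr Q0.
- by move=> n; rewrite weight_gt ?mulr0.
move=> n; pose K := Q ^+ n.+1 / (1 - Q ^+ (2 * n + 3)).
apply: (@alternating_sum_even_scaled K (fun r => K / Q ^+ r * weight Q 0 n.+1 r *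
  if r is r'.+1 then (-1) ^+ r * (Q ^+ 'C(r.+1, 2) + Q ^+ ('C(r.+1, 2) + r)) else 1)) => //=.
  by rewrite divr1 mulr1.
move=> r _; rewrite ['C(r.+2, 2)]binS bin1 !exprD !exprS; field.
by rewrite Q0 expf_neq0.
Qed.

Lemma weight_diag s n r : weight Q s n.+1 r.+1 = weight Q s.+2 n r.
Proof.
have e : (n.+1 + r.+1 + s = n + r + s.+2)%N by lia.
by rewrite /weight ltnS subSS e.
Qed.

Lemma weight_next2 s n r : Q != 0 -> (r <= n)%N ->
  weight Q s n r.+2 = weight Q s.+2 n r * (1 - Q ^+ (n - r)) * (1 - Q ^+ (n - r) / Q).
Proof.
move=> Q0 rn; have [->|neq] := eqVneq r n.
  by rewrite weight_gt ?subnn ?subrr ?mulr0 ?mul0r.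
have rn' : (r < n)%N by lia.
rewrite weight_next // weight_next // -(subnSK rn') exprS [Q * _]mulrC mulfK //.
Qed.

(** The same vanishing for the odd binomials [2M+1; M-r], with antidifference
    (-1)^r Q^(r(r-1)/2) (1 - Q^r) [2M; M-r] up to a factor free of r. *)
Lemma alternating_sum_odd M : (0 < M)%N ->
  \sum_(r < M.+1) (-1) ^+ r * (1 - Q ^+ (2 * r + 1)) * Q ^+ 'C(r, 2) * weight Q 1 M r = 0.
Proof.
move=> M0; have QM : 1 - Q ^+ M != 0 by rewrite -(prednK M0).
rewrite (telescope_ord (F := fun r => (-1) ^+ r * (1 - Q ^+ (2 * r + 1)) *
   Q ^+ 'C(r, 2) * weight Q 1 M r) (h := fun r => (-1) ^+ r * Q ^+ 'C(r, 2) * weight Q 1 M r *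
   (1 - Q ^+ r) * (1 - Q ^+ (M + r + 1)) / (1 - Q ^+ M))) => [|r rM].
  by rewrite /= [weight _ _ _ M.+1]weight_gt // [Q ^+ 0]expr0 subrr !(mulr0, mul0r) subrr.
rewrite -mulrBl; apply: (canRL (mulfK QM)).
rewrite [weight Q 1 M r.+1]weight_next // [weight Q 1 M r]weight_shift binS bin1.
have -> : (M + r + 1).+1 = ((M - r) + r + r + 2)%N by lia.
have -> : (M + r.+1 + 1)%N = ((M - r) + r + r + 2)%N by lia.
have -> : (M + r + 1)%N = ((M - r) + r + r + 1)%N by lia.
have -> : (2 * r + 1 = r + r + 1)%N by lia.
have -> : Q ^+ M = Q ^+ (M - r) * Q ^+ r by rewrite -exprD subnK.
rewrite !exprS !exprD; ring.
Qed.

(** Gauss's evaluation of the alternating sum of [2n; j], divided by (Q;Q)_(2n)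
    and folded to r >= 0. The sum for n+1 is minus a multiple of the sum for n,
    since the appropriate combination of the two is a telescoping sum with
    vanishing boundary terms. *)
Lemma gauss_alternating_sum n :
  (\sum_(r < n.+1) (-1) ^+ r * weight Q 0 n r) *+ 2 - weight Q 0 n 0 =
  (-1) ^+ n / poch (Q ^+ 2) (Q ^+ 2) n.
Proof.
have Q2 k : 1 - Q ^+ 2 * (Q ^+ 2) ^+ k != 0 by rewrite -exprS -exprM mulnS add2n.
elim: n => [|n IH].
  by rewrite big_ord1 /weight leqnn subnn !addn0 !poch0 expr0 !mulr1 invr1 !mulr1 mulr2n addrK.
pose h r := (-1) ^+ r * weight Q 0 n.+1 r * (1 - Q ^+ (n.+1 + r)).
have hE r : (r <= n.+1)%N -> (-1) ^+ r *
    ((1 - Q ^+ (2 * n + 2)) * weight Q 0 n.+1 r + weight Q 0 n r) = h r - h r.+1.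
  move=> rn; rewrite /h.
  rewrite [weight Q 0 n r]weight_shift [weight Q 1 n r]weight_grow // [weight Q 0 n.+1 r.+1]weight_next //.
  rewrite [weight Q 0 n.+1 r]weight_shift.
  have -> : (2 * n + 2 = ((n.+1 - r) + r) + ((n.+1 - r) + r))%N by lia.
  have -> : (n + r + 0).+1 = ((n.+1 - r) + r + r)%N by lia.
  have -> : (n.+1 + r + 0).+1 = ((n.+1 - r) + r + r + 1)%N by lia.
  have -> : (n.+1 + r.+1 = (n.+1 - r) + r + r + 1)%N by lia.
  have -> : (n.+1 + r = (n.+1 - r) + r + r)%N by lia.
  rewrite !exprS !exprD; ring.
(* folding the two-sided sum counts r = 0 once and every other r twice *)
have S1 : \sum_(r < n.+2) (-1) ^+ r *
    ((1 - Q ^+ (2 * n + 2)) * weight Q 0 n.+1 r + weight Q 0 n r) = h 0%N.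
  rewrite (telescope_ord (F := fun r => (-1) ^+ r * ((1 - Q ^+ (2 * n + 2)) *
    weight Q 0 n.+1 r + weight Q 0 n r)) (h := h)) //.
  by rewrite [h n.+2]/h weight_gt // mulr0 mul0r subr0.
have h01 : h 0%N + h 1%N = 0.
  have := weight_step 0 (leq0n n.+1); rewrite /h !addn0 subn0 addn1 => wE.
  by rewrite -!mulrA wE expr0 expr1; ring.
have E0 := hE 0%N (leq0n _); rewrite expr0 mul1r in E0.
have S2 : \sum_(r < n.+2) (-1) ^+ r *
    ((1 - Q ^+ (2 * n + 2)) * weight Q 0 n.+1 r + weight Q 0 n r) =
    (1 - Q ^+ (2 * n + 2)) * (\sum_(r < n.+2) (-1) ^+ r * weight Q 0 n.+1 r) +
    \sum_(r < n.+1) (-1) ^+ r * weight Q 0 n r.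
  have -> : \sum_(r < n.+1) (-1) ^+ r * weight Q 0 n r =
      \sum_(r < n.+2) (-1) ^+ r * weight Q 0 n r.
    by rewrite [RHS]big_ord_recr /= [weight _ _ n n.+1]weight_gt // mulr0 addr0.
  rewrite mulr_sumr.
  by rewrite -big_split /=; apply: eq_bigr => i _; ring.
set X' := \sum_(r < n.+2) (-1) ^+ r * weight Q 0 n.+1 r.
set X := \sum_(r < n.+1) (-1) ^+ r * weight Q 0 n r in IH S2.
have D0 : 1 - Q ^+ (2 * n + 2) != 0 by rewrite addnS.
apply: (mulfI D0).
have -> : (1 - Q ^+ (2 * n + 2)) * (X' *+ 2 - weight Q 0 n.+1 0) =
    - (X *+ 2 - weight Q 0 n 0).
  apply/eqP; rewrite -addr_eq0; apply/eqP.
  transitivity (((1 - Q ^+ (2 * n + 2)) * X' + X) *+ 2 -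
    ((1 - Q ^+ (2 * n + 2)) * weight Q 0 n.+1 0 + weight Q 0 n 0)); first by ring.
  by rewrite -S2 S1 E0 -h01; ring.
rewrite IH pochS [(-1) ^+ n.+1]exprS.
have <- : Q ^+ (2 * n + 2) = Q ^+ 2 * (Q ^+ 2) ^+ n.
  by rewrite -exprS -exprM; congr (_ ^+ _); lia.
field; rewrite D0 /=.
elim: (n) => [|k IHk]; rewrite ?poch0 ?oner_neq0 // pochS mulf_neq0 //.
Qed.

(** Here T_r = (-1)^r times the sum of Q^((3r^2+2r-j^2)/4) over |j| <= r of the
    parity of r. Two neighbouring parity classes do not mix, hence the step by
    two. *)
Lemma bailey_pair_f6 (T : nat -> L) : Q != 0 -> T 0%N = 1 -> T 1%N = - Q *+ 2 ->
  (forall r, T r.+2 = Q ^+ (3 * r + 4) * T r + ((-1) ^+ r * Q ^+ 'C(r.+3, 2)) *+ 2) ->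
  forall n, \sum_(r < n.+1) (1 - Q ^+ (2 * r + 2)) * T r * weight Q 2 n r =
    poch Q Q n / poch Q Q (2 * n + 1).
Proof.
move=> Q0 T0 T1 TS.
have Q1 : 1 - Q != 0 by exact: (hQ 0).
have P0 := one_add_exp_neq0.
pose c r := if r is r'.+1 then ((-1) ^+ r * Q ^+ 'C(r.+1, 2)) *+ 2 else 1.
pose K n := Q ^+ n.+1 / ((1 + Q ^+ n.+1) * (1 - Q ^+ (2 * n + 3))).
pose g n r := K n * (1 + Q ^+ r) / Q ^+ r * weight Q 0 n.+1 r.
have K1 n : 1 - Q ^+ (2 * n + 3) != 0 by rewrite addn3.
apply: (@bailey_pair_telescope2 _ _ (fun r => Q ^+ (3 * r + 4)) c
  (fun r => 1 - Q ^+ (2 * r + 2)) (fun n => poch Q Q n / poch Q Q (2 * n + 1))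
  (fun n => ((1 + Q ^+ n.+1) * (1 - Q ^+ (2 * n + 3)))^-1) g T0).
- by rewrite T1 /c expr1 mulN1r binn expr1.
- by move=> r; rewrite TS /c !exprS; congr (_ + _ *+ 2); ring.
- have Q2 := hQ 1; rewrite T0 /weight leqnn subnn muln0 !add0n !pochS !poch0.
  rewrite expr0 expr1 -expr2; field.
  by rewrite Q1 Q2.
- move=> n; have -> : (2 * n.+1 + 1 = (2 * n + 1).+2)%N by lia.
  have := poch_neq0 (2 * n + 1); have := hQ (2 * n + 1); have := P0 n; have := K1 n.
  rewrite (pochS Q Q (2 * n + 1).+1) (pochS Q Q n) (pochS Q Q (2 * n + 1)) -!exprS.
  have -> : (2 * n + 3 = (2 * n + 1).+2)%N by lia.
  have -> : (2 * n + 1).+1 = (n.+1 + n.+1)%N by lia.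
  rewrite (exprS _ (n.+1 + n.+1)) exprD => *; field.
  by do ?[apply/andP; split].
- move=> n r rn; rewrite /g /K; have := K1 n; have := P0 n.
  have Qr : Q ^+ r != 0 by rewrite expf_neq0.
  rewrite [weight Q 2 n r]weight_grow // [weight Q 0 n.+1 r.+2]weight_next2 //.
  rewrite [weight Q 0 n.+1 r]weight_shift [weight Q 1 n.+1 r]weight_shift.
  have -> : (n.+1 + r + 1).+1 = ((n.+1 - r) + r + r + 2)%N by lia.
  have -> : (n.+1 + r + 0).+1 = ((n.+1 - r) + r + r + 1)%N by lia.
  have -> : (2 * n + 3 = ((n.+1 - r) + r) + ((n.+1 - r) + r) + 1)%N by lia.
  have -> : (2 * r + 2 = r + r + 2)%N by lia.
  have -> : (3 * r + 4 = r + r + r + 4)%N by lia.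
  have -> : Q ^+ n.+1 = Q ^+ ((n.+1 - r) + r) by congr (_ ^+ _); lia.
  rewrite !exprS !exprD => K0 K2; field.
  by rewrite Qr Q0 K0 K2.
- by move=> n; rewrite /g weight_gt ?mulr0.
- by move=> n; rewrite /g weight_gt ?mulr0.
move=> n; apply: (@alternating_sum_even_scaled (K n *+ 2) (fun r => g n r * c r)) => //.
  by rewrite /g /c expr0 divr1 mulr1 mulrDr mulr1 mulr2n.
move=> r _; rewrite /g /c ['C(r.+2, 2)]binS bin1 !exprD !exprS; field.
by rewrite Q0 expf_neq0.
Qed.

Section Conjugate.
Variables (z : L) (s : nat).
Hypothesis hz : forall k, 1 - z * Q ^+ k != 0.

Definition zpow n := \prod_(i < n) (z - Q ^+ (s.+1 + i)).

Lemma zpowS n : zpow n.+1 = zpow n * (z - Q ^+ (s.+1 + n)).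
Proof. by rewrite /zpow big_ord_recr. Qed.

(** delta_n = (Q;Q)_n (rho;Q)_n z^n with rho = Q^(s+1)/z, written so that z = 0, the
    limit rho -> oo, is allowed. *)
Definition delta n := poch Q Q n * zpow n.

(** The value, by the q-Gauss sum, of the sum of delta_n weight(n, r) over n, for the
    weight with shift s+1. *)
Definition gamma r :=
  poch Q Q r * zpow r / (poch Q Q (r + s) * poch z Q r.+1).

Definition gamma_ratio r := (1 - Q ^+ r.+1) * (z - Q ^+ (s.+1 + r)) /
   ((1 - Q ^+ (s.+1 + r)) * (1 - z * Q ^+ r.+1)).

(** The rational certificate of the recursion in r for the q-Gauss sum. As a
    function of Q^(n-r) it is linear; its two coefficients are forced by comparing
    the recursion at Q^(n-r) = 0 and at Q^(n+1) = 1. *)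
Definition conjugate_cert r n :=
  (Q ^+ r * Q ^+ s.+2 * (1 - Q ^+ s.+2 * (Q ^+ r) ^+ 2) * Q ^+ r * Q ^+ (n - r)
    - Q ^+ s.+1 * Q ^+ r - Q * Q ^+ r * z + Q ^+ s.+2 * (Q ^+ r) ^+ 2 * (1 + z)) /
   ((1 - Q ^+ (s.+1 + r)) * (1 - z * Q ^+ r.+1)).

Lemma poch_z k : poch z Q k != 0.
Proof. by elim: k => [|k IH]; rewrite ?poch0 ?oner_neq0 // pochS mulf_neq0. Qed.

Lemma gammaS r : gamma r.+1 = gamma_ratio r * gamma r.
Proof.
have h1 : 1 - Q ^+ (s.+1 + r) != 0 by rewrite addSn.
have := hz r.+1; have := poch_z r.+1; have := poch_neq0 (r + s).
rewrite /gamma /gamma_ratio (addSn r s) zpowS (pochS z Q r.+1) (pochS Q Q r) (pochS Q Q (r + s)).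
rewrite -!exprS (addnC r s) -addSn => *; field.
by do ?[apply/andP; split].
Qed.

(** The case r = 0 telescopes, so the remainder after N terms is explicit. *)
Lemma conjugate_base N :
  \sum_(n < N.+1) delta n * weight Q s.+1 n 0 =
  gamma 0 - zpow N.+1 / (poch Q Q (N.+1 + s) * (1 - z)).
Proof.
have z1 : 1 - z != 0 by have := hz 0; rewrite expr0 mulr1.
rewrite (telescope_ord (F := fun n => delta n * weight Q s.+1 n 0)
   (h := fun n => zpow n / (poch Q Q (n + s) * (1 - z)))) => [|n _].
  congr (_ / _ - _); first by rewrite poch0 mul1r.
  by rewrite pochS poch0 expr0 mulr1 mul1r.
have := poch_neq0 (n + s); have := poch_neq0 n; have := hQ (n + s).
rewrite /delta /weight /= subn0 addn0 addnS zpowS addSn !pochS -exprS.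
rewrite (addnC s n) => *; field.
by do ?[apply/andP; split].
Qed.

Lemma conjugate_step r n :
  delta n.+1 * weight Q s.+1 n.+1 r.+1 - gamma_ratio r * (delta n * weight Q s.+1 n r) =
  delta n.+1 * weight Q s.+1 n.+1 r.+1 * conjugate_cert r n.+1 -
  delta n * weight Q s.+1 n r.+1 * conjugate_cert r n.
Proof.
have [rn|initial_range] := leqP r n; last first.
  by rewrite !weight_gt //; [ring | lia].
have h1 : 1 - Q ^+ (s.+1 + r) != 0 by rewrite addSn.
have h2 := hz r.+1.
rewrite weight_diag [weight _ _ n r.+1]weight_next // [weight Q s.+1 n r]weight_shift [weight Q s.+2 n r]weight_shift.
rewrite /gamma_ratio /conjugate_cert /delta pochS zpowS subSn //.
move: h1 h2.
have -> : (s.+1 + n = s + ((n - r) + r) + 1)%N by lia.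
have -> : (n + r + s.+2).+1 = (s + (n - r) + r + r + 3)%N by lia.
have -> : (n + r + s.+1).+1 = (s + (n - r) + r + r + 2)%N by lia.
have -> : Q ^+ n = Q ^+ (n - r) * Q ^+ r by rewrite -exprD subnK.
rewrite !exprS !exprD => h1 h2; field.
by rewrite h2.
Qed.

End Conjugate.
End Base.

Section Square.
Variable q : L.
Hypothesis hq : forall k, 1 - q ^+ k.+1 != 0.
Hypothesis q0 : q != 0.
Local Notation Q := (q ^+ 2).

Lemma one_sub_sqr_exp_neq0 k : 1 - Q ^+ k.+1 != 0.
Proof. by rewrite -exprM mulnS add2n. Qed.

Lemma exprsq k : Q ^+ k = (q ^+ k) ^+ 2.
Proof. by rewrite exprAC. Qed.

Lemma poch_opp_neq0 k : poch (- q) q k != 0.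
Proof.
by elim: k => [|k IH]; rewrite ?poch0 ?oner_neq0 // pochS mulf_neq0 // mulNr opprK -exprS (one_add_exp_neq0 hq).
Qed.

(** Here T_r = q^(2r^2+r) sum_(|j| <= r) (-1)^j q^(-j^2). The Gosper certificate
    carries the factor 1 + q^(2r), and the remaining sum is [alternating_sum_even] in
    base q^2. *)
Lemma bailey_pair_f7 (T : nat -> L) : T 0%N = 1 ->
  (forall r, T r.+1 = q ^+ (4 * r + 3) * T r + ((-1) ^+ r.+1 * Q ^+ 'C(r.+2, 2)) *+ 2) ->
  forall n, \sum_(r < n.+1) (1 - q ^+ (2 * r + 1)) * T r * weight Q 1 n r =
    (poch (- q) q (2 * n + 1))^-1.
Proof.
move=> T0 TS.
pose c r := if r is r'.+1 then ((-1) ^+ r * Q ^+ 'C(r.+1, 2)) *+ 2 else 1.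
pose K n := q ^+ (2 * n + 2) / ((1 + q ^+ (2 * n + 2)) * (1 + q ^+ (2 * n + 3))).
pose g n r := K n * (1 + q ^+ (2 * r)) / q ^+ (2 * r) * weight Q 0 n.+1 r.
have K1 n : 1 + q ^+ (2 * n + 3) != 0 by rewrite addn3 (one_add_exp_neq0 hq).
have K2 n : 1 + q ^+ (2 * n + 2) != 0 by rewrite addn2 (one_add_exp_neq0 hq).
apply: (@bailey_pair_telescope _ _ _ (fun r => q ^+ (4 * r + 3)) c
  (fun r => 1 - q ^+ (2 * r + 1)) (fun n => (poch (- q) q (2 * n + 1))^-1)
  (fun n => ((1 + q ^+ (2 * n + 2)) * (1 + q ^+ (2 * n + 3)))^-1) g T0).
- by move=> r; rewrite TS.
- rewrite T0 /weight leqnn subnn muln0 !add0n !pochS !poch0 expr0 expr1 mulr1.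
  have q1 := hq 1; have q2 := one_add_exp_neq0 hq 0; rewrite expr1 in q2.
  by field; rewrite q1 opprK.
- move=> n; have -> : (2 * n.+1 + 1 = (2 * n + 1).+2)%N by lia.
  rewrite 2!pochS !mulNr !opprK -!exprS.
  have -> : (2 * n + 1).+1 = (2 * n + 2)%N by lia.
  have -> : (2 * n + 2).+1 = (2 * n + 3)%N by lia.
  by have := poch_opp_neq0 (2 * n + 1) => *; field; rewrite K1 K2; apply/andP.
- move=> n r rn; rewrite /g /K; have := K1 n; have := K2 n.
  have qr : q ^+ r != 0 by rewrite expf_neq0.
  rewrite [weight Q 1 n r](weight_grow one_sub_sqr_exp_neq0) // [weight Q 0 n.+1 r.+1](weight_next one_sub_sqr_exp_neq0) //.
  rewrite [weight Q 0 n.+1 r](weight_shift one_sub_sqr_exp_neq0).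
  rewrite !exprsq.
  have -> : (n.+1 + r + 0).+1 = ((n.+1 - r) + r + r + 1)%N by lia.
  have -> : (2 * n + 3 = ((n.+1 - r) + r) + ((n.+1 - r) + r) + 1)%N by lia.
  have -> : (2 * n + 2 = ((n.+1 - r) + r) + ((n.+1 - r) + r))%N by lia.
  have -> : (2 * r + 1 = r + r + 1)%N by lia.
  have -> : (2 * r.+1 = r + r + 2)%N by lia.
  have -> : (2 * r = r + r)%N by lia.
  have -> : (4 * r + 3 = r + r + r + r + 3)%N by lia.
  rewrite !exprD => K0 K0'; field.
  by rewrite qr q0 K0 K0'.
- by move=> n; rewrite /g weight_gt ?mulr0.
move=> n; apply: (@alternating_sum_even_scaled _ one_sub_sqr_exp_neq0 (K n *+ 2) (fun r => g n r * c r)) => //.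
  by rewrite /g /c muln0 expr0 divr1 mulr1 mulrDr mulr1 mulr2n.
move=> r _; rewrite /g /c ['C(r.+2, 2)]binS bin1 (exprM q 2) !exprD !exprS; field.
by rewrite q0 andbT expf_neq0 // expr0 mulr1 mulf_neq0.
Qed.

(** Here T_r = q^(2r^2+3r) sum_(0 <= j <= r) (-1)^j (1 - q^(2j+1)) q^(-j^2-2j), a
    theta series folded about j = -1/2; the remaining sum is accordingly
    [alternating_sum_odd]. *)
Lemma bailey_pair_f4 (T : nat -> L) : T 0%N = 1 - q ->
  (forall r, T r.+1 = q ^+ (4 * r + 5) * T r +
     (-1) ^+ r.+1 * (1 - q ^+ (2 * r + 3)) * Q ^+ 'C(r.+2, 2)) ->
  forall n, \sum_(r < n.+1) (1 - q ^+ (2 * r + 2)) * T r * weight Q 2 n r =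
    (poch (- q) q (2 * n + 2))^-1.
Proof.
move=> T0 TS.
pose c r := (-1) ^+ r * (1 - q ^+ (2 * r + 1)) * Q ^+ 'C(r.+1, 2).
pose K n := q ^+ (2 * n + 2) / ((1 + q ^+ (2 * n + 3)) * (1 + q ^+ (2 * n + 4))).
pose g n r := K n * (1 + q ^+ (2 * r + 1)) / q ^+ (2 * r) * weight Q 1 n.+1 r.
have K1 n : 1 + q ^+ (2 * n + 3) != 0 by rewrite addn3 (one_add_exp_neq0 hq).
have K2 n : 1 + q ^+ (2 * n + 4) != 0 by rewrite addn4 (one_add_exp_neq0 hq).
apply: (@bailey_pair_telescope _ _ _ (fun r => q ^+ (4 * r + 5)) c
  (fun r => 1 - q ^+ (2 * r + 2)) (fun n => (poch (- q) q (2 * n + 2))^-1)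
  (fun n => ((1 + q ^+ (2 * n + 3)) * (1 + q ^+ (2 * n + 4)))^-1) g).
- by rewrite T0 /c expr0 mul1r bin_small // expr0 mulr1 muln0 add0n expr1.
- by move=> r; rewrite TS /c; have -> : (2 * r.+1 + 1 = 2 * r + 3)%N by lia.
- rewrite T0 /weight leqnn subnn muln0 !add0n !pochS !poch0 expr0 !expr1 mulr1.
  rewrite mulNr opprK -expr2 -exprD.
  have q1 := hq 0; have q2 := one_add_exp_neq0 hq 0; have q4 := hq 3; have q5 := one_add_exp_neq0 hq 1.
  have q6 := hq 1.
  rewrite expr1 in q1 q2.
  by field; rewrite q4 q6 opprK q5 q2.
- move=> n; have -> : (2 * n.+1 + 2 = (2 * n + 2).+2)%N by lia.
  rewrite 2!pochS !mulNr !opprK -!exprS.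
  have -> : (2 * n + 2).+1 = (2 * n + 3)%N by lia.
  have -> : (2 * n + 3).+1 = (2 * n + 4)%N by lia.
  by have := poch_opp_neq0 (2 * n + 2) => *; field; rewrite K1 K2; apply/andP.
- move=> n r rn; rewrite /g /K; have := K1 n; have := K2 n.
  have qr : q ^+ r != 0 by rewrite expf_neq0.
  rewrite [weight Q 2 n r](weight_grow one_sub_sqr_exp_neq0) // [weight Q 1 n.+1 r.+1](weight_next one_sub_sqr_exp_neq0) //.
  rewrite [weight Q 1 n.+1 r](weight_shift one_sub_sqr_exp_neq0).
  rewrite !exprsq.
  have -> : (n.+1 + r + 1).+1 = ((n.+1 - r) + r + r + 2)%N by lia.
  have -> : (2 * n + 4 = ((n.+1 - r) + r) + ((n.+1 - r) + r) + 2)%N by lia.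
  have -> : (2 * n + 3 = ((n.+1 - r) + r) + ((n.+1 - r) + r) + 1)%N by lia.
  have -> : (2 * n + 2 = ((n.+1 - r) + r) + ((n.+1 - r) + r))%N by lia.
  have -> : (2 * r + 1 = r + r + 1)%N by lia.
  have -> : (2 * r + 2 = r + r + 2)%N by lia.
  have -> : (2 * r.+1 + 1 = r + r + 3)%N by lia.
  have -> : (2 * r.+1 = r + r + 2)%N by lia.
  have -> : (2 * r = r + r)%N by lia.
  have -> : (4 * r + 5 = r + r + r + r + 5)%N by lia.
  rewrite !exprD => K0 K0'; field.
  by rewrite qr q0 K0 K0'.
- by move=> n; rewrite /g weight_gt ?mulr0.
move=> n; have := congr1 ( *%R (K n)) (alternating_sum_odd one_sub_sqr_exp_neq0 (ltn0Sn n)).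
rewrite mulr0 mulr_sumr; apply: etrans.
apply: eq_bigr => -[r /= _] _; rewrite /g /c binS bin1 [Q ^+ ('C(r, 2) + r)]exprD.
rewrite (exprsq r) (exprsq (2 * r + 1)) exprD [(2 * r)%N]mulnC exprM; field.
by rewrite expf_neq0.
Qed.

(** Here T_r = (-1)^r q^(r^2) sum_(|j| <= r) q^(-j^2). The weights have an
    antidifference for fixed n, without passing to a difference in n; the
    theta terms q^(-j^2) cancel against the prefactor q^(r^2) at r = j, leaving
    Gauss's alternating sum. *)
Lemma bailey_pair_f1 (T : nat -> L) : T 0%N = 1 ->
  (forall r, T r.+1 = - q ^+ (2 * r + 1) * T r + (-1) ^+ r.+1 *+ 2) ->
  forall n, \sum_(r < n.+1) (1 + q ^+ (2 * r + 1)) * T r * weight Q 1 n r =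
    (-1) ^+ n / (poch (Q ^+ 2) (Q ^+ 2) n * (1 - q ^+ (2 * n + 1))).
Proof.
move=> T0 TS n.
have K0 : 1 - q ^+ (2 * n + 1) != 0 by rewrite addn1.
pose c r : L := if r is r'.+1 then (-1) ^+ r *+ 2 else 1.
pose g r := weight Q 0 n r / (1 - q ^+ (2 * n + 1)).
rewrite (eq_bigr (fun r : 'I_n.+1 => ((1 + q ^+ (2 * r + 1)) * weight Q 1 n r) * T r));
  last by move=> r _; rewrite mulrAC.
rewrite (double_telescope (u := fun r => - q ^+ (2 * r + 1)) (c := c) (g := g)
  (f := fun r => (1 + q ^+ (2 * r + 1)) * weight Q 1 n r)) //.
- rewrite invfM mulrA -(gauss_alternating_sum one_sub_sqr_exp_neq0) /g [in LHS]big_ord_recl [in RHS]big_ord_recl /=.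
  have -> : \sum_(i < n) weight Q 0 n (bump 0 i) / (1 - q ^+ (2 * n + 1)) *
      ((-1) ^+ bump 0 i *+ 2) =
      (\sum_(i < n) (-1) ^+ bump 0 i * weight Q 0 n (bump 0 i)) *+ 2 /
      (1 - q ^+ (2 * n + 1)).
    rewrite -sumrMnl mulr_suml; apply: eq_bigr => i _; ring.
  ring.
- move=> r rn; rewrite /g [weight Q 0 n r.+1](weight_next one_sub_sqr_exp_neq0) // [weight Q 0 n r](weight_shift one_sub_sqr_exp_neq0).
  move: K0; rewrite !exprsq.
  have -> : (n + r + 0).+1 = ((n - r) + r + r + 1)%N by lia.
  have -> : (2 * n + 1 = ((n - r) + r) + ((n - r) + r) + 1)%N by lia.
  have -> : (2 * r + 1 = r + r + 1)%N by lia.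
  by rewrite !exprD => K0; field.
- by rewrite /g weight_gt ?mul0r.
Qed.

End Square.
End Finite.

(** * Orders of vanishing and Bailey's lemma *)

Section Series.
Variables (L : fieldType) (iota : {rmorphism {poly int} -> L}).
Hypothesis iota_inj : injective iota.
Local Notation x := (iota 'X).

(** y is x^k times a quotient of polynomials in x whose denominator has constant
    term 1: it expands as a power series in x divisible by x^k. For k = 0 such
    elements form a ring, called regular below. *)
Definition ord_ge (k : nat) (y : L) : Prop :=
  exists P D : {poly int}, D`_0 = 1 /\ y = x ^+ k * (iota P / iota D).

Lemma iota_neq0 (D : {poly int}) : D`_0 = 1 -> iota D != 0.
Proof.
move=> D0; rewrite -(rmorph0 iota) (inj_eq iota_inj).
by apply/eqP => D00; move: D0; rewrite D00 coef0.
Qed.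

Lemma x_neq0 : x != 0.
Proof. by rewrite -(rmorph0 iota) (inj_eq iota_inj) polyX_eq0. Qed.

Lemma coef0M1 (D E : {poly int}) : D`_0 = 1 -> E`_0 = 1 -> (D * E)`_0 = 1.
Proof. by move=> D0 E0; rewrite coef0M D0 E0 mulr1. Qed.

Lemma ord_ge_poly k (P : {poly int}) : ord_ge k (x ^+ k * iota P).
Proof. by exists P, 1; rewrite coef1 (rmorph1 iota) divr1. Qed.

Lemma regular_poly (P : {poly int}) : ord_ge 0 (iota P).
Proof. by have := ord_ge_poly 0 P; rewrite mul1r. Qed.

Lemma ord_ge_zero k : ord_ge k 0.
Proof. by exists 0, 1; rewrite coef1 (rmorph0 iota) mul0r mulr0. Qed.

Lemma ord_ge_Xn k : ord_ge k (x ^+ k).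
Proof. by have := ord_ge_poly k 1; rewrite (rmorph1 iota) mulr1. Qed.

Lemma ord_geN k y : ord_ge k y -> ord_ge k (- y).
Proof. by move=> [P [D [D0 ->]]]; exists (- P), D; rewrite rmorphN mulNr mulrN. Qed.

Lemma ord_geD k y z : ord_ge k y -> ord_ge k z -> ord_ge k (y + z).
Proof.
move=> [P [D [D0 ->]]] [P' [D' [D0' ->]]].
exists (P * D' + P' * D), (D * D'); rewrite coef0M1 // rmorphD !rmorphM /=.
have := iota_neq0 D0; have := iota_neq0 D0' => h h'; split=> //.
by field; rewrite h h'.
Qed.

Lemma ord_geB k y z : ord_ge k y -> ord_ge k z -> ord_ge k (y - z).
Proof. by move=> hy hz; apply: ord_geD => //; apply: ord_geN. Qed.

Lemma ord_geM k l y z : ord_ge k y -> ord_ge l z -> ord_ge (k + l) (y * z).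
Proof.
move=> [P [D [D0 ->]]] [P' [D' [D0' ->]]].
exists (P * P'), (D * D'); rewrite coef0M1 // !rmorphM /= exprD.
have := iota_neq0 D0; have := iota_neq0 D0' => h h'; split=> //.
by field; rewrite h h'.
Qed.

Lemma ord_geMl k y z : ord_ge 0 y -> ord_ge k z -> ord_ge k (y * z).
Proof. exact: ord_geM. Qed.

Lemma ord_geMr k y z : ord_ge k y -> ord_ge 0 z -> ord_ge k (y * z).
Proof. by move=> hy hz; rewrite mulrC; apply: ord_geMl. Qed.

Lemma ord_geW k l y : (k <= l)%N -> ord_ge l y -> ord_ge k y.
Proof.
move=> kl [P [D [D0 ->]]]; exists ('X^(l - k) * P), D; split=> //.
by rewrite rmorphM rmorphXn /= -(subnKC kl) exprD addKn !mulrA.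
Qed.

Lemma ord_ge_sum k (I : Type) (r : seq I) (F : I -> L) :
  (forall i, ord_ge k (F i)) -> ord_ge k (\sum_(i <- r) F i).
Proof. by move=> hF; apply: big_ind => //; [exact: ord_ge_zero | exact: ord_geD]. Qed.

Lemma ord_geX k n y : ord_ge k y -> ord_ge (n * k) (y ^+ n).
Proof.
move=> hy; elim: n => [|n IH]; first by rewrite mul0n expr0; have := ord_ge_Xn 0.
by rewrite exprS mulSn; apply: ord_geM.
Qed.

Lemma regular1 : ord_ge 0 1.
Proof. by have := ord_ge_Xn 0. Qed.

Lemma regularX n y : ord_ge 0 y -> ord_ge 0 (y ^+ n).
Proof. by move=> /(ord_geX n); rewrite muln0. Qed.

(** A power series with constant term 1; its inverse is again regular. *)
Definition principal_unit y := ord_ge 1 (y - 1).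

Lemma principal_unit_sub y : ord_ge 1 y -> principal_unit (1 - y).
Proof. by move=> hy; rewrite /principal_unit addrAC subrr sub0r; apply: ord_geN. Qed.

Lemma principal_unit_form y : principal_unit y ->
  exists P D : {poly int}, [/\ P`_0 = 1, D`_0 = 1 & y = iota P / iota D].
Proof.
move=> [P [D [D0 e]]]; exists (D + 'X * P), D.
have h := iota_neq0 D0; split => //.
  by rewrite coefD D0 coefXM eqxx addr0.
by move/(canRL (subrK 1)): e => ->; rewrite rmorphD rmorphM /=; field.
Qed.

Lemma principal_unit_neq0 y : principal_unit y -> y != 0.
Proof.
by move=> /principal_unit_form[P [D [P0 D0 ->]]]; rewrite mulf_neq0 ?invr_eq0 ?iota_neq0.
Qed.

Lemma regular_inv y : principal_unit y -> ord_ge 0 y^-1.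
Proof.
move=> /principal_unit_form[P [D [P0 D0 ->]]]; exists D, P; split => //.
by rewrite expr0 mul1r invf_div.
Qed.

Lemma principal_unitM y z : principal_unit y -> principal_unit z -> principal_unit (y * z).
Proof.
move=> hy hz; rewrite /principal_unit.
have -> : y * z - 1 = (y - 1) * (z - 1) + (y - 1) + (z - 1) by ring.
apply: ord_geD => //; apply: ord_geD => //.
by apply: (ord_geW (l := 1 + 1)) => //; apply: ord_geM.
Qed.

Lemma principal_unit1 : principal_unit 1.
Proof. by rewrite /principal_unit subrr; apply: ord_ge_zero. Qed.

Lemma principal_unit_poch a Q n : ord_ge 1 a -> ord_ge 0 Q -> principal_unit (poch a Q n).
Proof.
move=> ha hQ; elim: n => [|n IH]; first by rewrite poch0; exact: principal_unit1.
rewrite pochS; apply: principal_unitM => //; apply: principal_unit_sub.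
by apply: ord_geMr => //; apply: regularX.
Qed.

Lemma regular_principal_unit y : principal_unit y -> ord_ge 0 y.
Proof.
by move=> /principal_unit_form[P [D [_ D0 ->]]]; exists P, D; split=> //; rewrite expr0 mul1r.
Qed.

Section Bailey.
Variables (Q z : L) (s : nat).
Hypotheses (Q1 : ord_ge 1 Q) (z1 : ord_ge 1 z).

Lemma ord_ge_base k : ord_ge 1 (Q ^+ k.+1).
Proof. by apply: (ord_geW (l := k.+1 * 1)) => //; apply: ord_geX. Qed.

Lemma regular_base k : ord_ge 0 (Q ^+ k).
Proof. by apply: regularX; apply: (ord_geW (l := 1)). Qed.

Lemma base_neq0 k : 1 - Q ^+ k.+1 != 0.
Proof. by apply: principal_unit_neq0; apply: principal_unit_sub; apply: ord_ge_base. Qed.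

Lemma base_z_neq0 k : 1 - z * Q ^+ k != 0.
Proof. by apply: principal_unit_neq0; apply: principal_unit_sub; apply: ord_geMr => //; apply: regular_base. Qed.

Lemma ord_ge_zpow n : ord_ge n (zpow Q z s n).
Proof.
elim: n => [|n IH]; first by rewrite /zpow big_ord0; exact: regular1.
rewrite zpowS -addn1; apply: ord_geM => //; apply: ord_geB => //.
by rewrite addSn; apply: ord_ge_base.
Qed.

Lemma principal_unit_pochQ n : principal_unit (poch Q Q n).
Proof. by apply: principal_unit_poch => //; apply: (ord_geW (l := 1)). Qed.

Lemma regular_weight t n r : ord_ge 0 (weight Q t n r).
Proof.
rewrite /weight; case: ifP => _; last exact: ord_ge_zero.
by apply: regular_inv; apply: principal_unitM; apply: principal_unit_pochQ.
Qed.

Lemma ord_ge_delta n : ord_ge n (delta Q z s n).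
Proof. by apply: ord_geMl; [apply/regular_principal_unit/principal_unit_pochQ | exact: ord_ge_zpow]. Qed.

Lemma ord_ge_gamma r : ord_ge r (gamma Q z s r).
Proof.
apply: ord_geMr; first by apply: ord_geMl; [apply/regular_principal_unit/principal_unit_pochQ | exact: ord_ge_zpow].
apply: regular_inv; apply: principal_unitM; first exact: principal_unit_pochQ.
by apply: principal_unit_poch => //; apply: (ord_geW (l := 1)).
Qed.

Lemma principal_unit_ratio_den r : principal_unit ((1 - Q ^+ (s.+1 + r)) * (1 - z * Q ^+ r.+1)).
Proof.
apply: principal_unitM; apply: principal_unit_sub; first by rewrite addSn; apply: ord_ge_base.
by apply: ord_geMr => //; apply: regular_base.
Qed.

Lemma ord_ge_gamma_ratio r : ord_ge 1 (gamma_ratio Q z s r).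
Proof.
apply: ord_geMr; last by apply/regular_inv/principal_unit_ratio_den.
apply: ord_geMl; first by apply/regular_principal_unit/principal_unit_sub/ord_ge_base.
by apply: ord_geB => //; rewrite addSn; apply: ord_ge_base.
Qed.

Lemma regular_conjugate_cert r n : ord_ge 0 (conjugate_cert Q z s r n).
Proof.
have hQ : ord_ge 0 Q by apply: (ord_geW (l := 1)).
have hz : ord_ge 0 z by apply: (ord_geW (l := 1)).
apply: ord_geMl; last by apply/regular_inv/principal_unit_ratio_den.
by do ![exact: regular_base | exact: hQ | exact: hz | exact: regular1 | apply: ord_geB | apply: ord_geD |
  apply: ord_geMl | apply: regularX].
Qed.

(** The value of the conjugate sum, as a statement on its partial sums. The
    error at r+1 and N+1 is gamma_(r+1)/gamma_r, of order 1, times the error at r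
    and N, plus the boundary term of the certificate, of order N+1. *)
Lemma conjugate_estimate r N :
  ord_ge N (\sum_(n < N.+1) delta Q z s n * weight Q s.+1 n r - gamma Q z s r).
Proof.
elim: r N => [|r IH] N.
  rewrite (conjugate_base base_neq0 s base_z_neq0).
  rewrite addrAC subrr sub0r; apply: ord_geN; apply: ord_geMr.
    by apply: (ord_geW (l := N.+1)) => //; exact: ord_ge_zpow.
  apply: regular_inv; apply: principal_unitM; first exact: principal_unit_pochQ.
  exact: principal_unit_sub.
case: N => [|N].
  rewrite big_ord1 weight_gt // mulr0 sub0r; apply: ord_geN.
  by apply: ord_geW (ord_ge_gamma _).
rewrite big_ord_recl /= weight_gt // mulr0 add0r.
have -> : \sum_(i < N.+1) delta Q z s (bump 0 i) * weight Q s.+1 (bump 0 i) r.+1 -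
    gamma Q z s r.+1 =
    gamma_ratio Q z s r * (\sum_(n < N.+1) delta Q z s n * weight Q s.+1 n r - gamma Q z s r) +
    delta Q z s N.+1 * weight Q s.+1 N.+1 r.+1 * conjugate_cert Q z s r N.+1.
  rewrite (gammaS base_neq0 s base_z_neq0) mulrBr addrAC; congr (_ - _).
  apply/eqP; rewrite addrC -subr_eq mulr_sumr -sumrB; apply/eqP.
  rewrite (telescope_ord (F := fun n => delta Q z s (bump 0 n) *
       weight Q s.+1 (bump 0 n) r.+1 - gamma_ratio Q z s r * (delta Q z s n * weight Q s.+1 n r))
    (h := fun n => - (delta Q z s n * weight Q s.+1 n r.+1 * conjugate_cert Q z s r n))).
    by rewrite opprK weight_gt // mulr0 mul0r oppr0 add0r.
  by move=> n _; rewrite (conjugate_step base_neq0 s base_z_neq0) opprK addrC.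
apply: ord_geD; first by rewrite -add1n; apply: ord_geM => //; exact: ord_ge_gamma_ratio.
apply: ord_geMr; last exact: regular_conjugate_cert.
by apply: ord_geMr; [exact: ord_ge_delta | exact: regular_weight].
Qed.

(** Exchanging summations on the square n, r <= N is exact since the weight
    vanishes for r > n; the tails of the conjugate sums have order N. *)
Theorem bailey_lemma (alpha beta : nat -> L) :
  (forall r, ord_ge 0 (alpha r)) ->
  (forall n, \sum_(r < n.+1) alpha r * weight Q s.+1 n r = beta n) ->
  forall N, ord_ge N (\sum_(n < N.+1) delta Q z s n * beta n -
                   \sum_(r < N.+1) alpha r * gamma Q z s r).
Proof.
move=> ra ab N.
have -> : \sum_(n < N.+1) delta Q z s n * beta n =
  \sum_(r < N.+1) alpha r * (\sum_(n < N.+1) delta Q z s n * weight Q s.+1 n r).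
  rewrite [RHS](eq_bigr (fun r : 'I_N.+1 =>
     \sum_(n < N.+1) delta Q z s n * (alpha r * weight Q s.+1 n r))); last first.
    by move=> r _; rewrite mulr_sumr; apply: eq_bigr => n _; rewrite mulrCA.
  rewrite exchange_big /=; apply: eq_bigr => n _; rewrite -mulr_sumr; congr (_ * _).
  rewrite -ab (big_ord_widen N.+1 (fun r => alpha r * weight Q s.+1 n r)) //.
  rewrite big_mkcond /=; apply: eq_bigr => r _.
  by case: ltnP => // initial_range; rewrite weight_gt // mulr0.
rewrite -sumrB; apply: ord_ge_sum => r; rewrite -mulrBr.
by apply: ord_geMl => //; apply: conjugate_estimate.
Qed.

End Bailey.

(** An element of the localized ring that is a polynomial and divisible by x^K has
    no coefficient below K, as the denominator is invertible modulo x^K. *)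
Lemma ord_ge_coef (P : {poly int}) K k : ord_ge K (iota P) -> (k < K)%N -> P`_k = 0.
Proof.
move=> [A [B [B0 e]]] kK.
have hB := iota_neq0 B0.
have {e} PB : P * B = 'X^K * A.
  by apply: iota_inj; rewrite !rmorphM rmorphXn /= e; field.
elim/ltn_ind: k kK => i IH iK.
have : (P * B)`_i = 0 by rewrite PB coefXnM iK.
rewrite coefMr big_ord_recl subn0 B0 mulr1 big1 ?addr0 // => j _.
by have ji := ltn_ord j; rewrite -[nat_of_ord (lift _ _)]/(j.+1) IH ?mul0r //; lia.
Qed.

(** The passage from rational functions to power series: modulo x^K the inverse
    of D is the truncated geometric series in 1 - D. *)
Lemma fps_div_sum (N D : nat -> {poly int}) (P : {poly int}) M K k :
  (forall n, (D n)`_0 = 1) ->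
  ord_ge K (\sum_(n < M) iota (N n) / iota (D n) - iota P) -> (k < K)%N ->
  \sum_(n < M) fps_div (N n) (D n) k = P`_k.
Proof.
move=> D0 hP kK.
(* the inverse of D modulo x^K *)
pose G n := \sum_(i < K) (1 - D n) ^+ i.
have DG n : D n * G n = 1 - (1 - D n) ^+ K.
  by rewrite -[RHS]opprB subrX1 -mulNr opprB subKr.
rewrite (eq_bigr (fun n : 'I_M => (N n * G n)`_k)) => [|n _]; last first.
  by rewrite (fps_div_trunc (M := K) _ (D0 n) kK) -mulr_sumr.
rewrite -coef_sum; apply/eqP; rewrite -subr_eq0 -coefB; apply/eqP.
apply: ord_ge_coef kK; rewrite rmorphB rmorph_sum /=.
have -> : \sum_(n < M) iota (N n * G n) - iota P =
   (\sum_(n < M) iota (N n) / iota (D n) - iota P) -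
   \sum_(n < M) (iota (N n) / iota (D n) * iota ((1 - D n) ^+ K)).
  rewrite addrAC -sumrB; congr (_ - _); apply: eq_bigr => n _.
  have hD := iota_neq0 (D0 n).
  rewrite rmorphM /=; apply: (mulfI hD).
  rewrite mulrCA -[iota (D n) * iota (G n)]rmorphM /= DG rmorphB rmorph1.
  by field.
apply: ord_geB => //; apply: ord_ge_sum => n; apply: ord_geMl.
  by exists (N n), (D n); rewrite expr0 mul1r.
rewrite rmorphXn /= -{1}[K]muln1; apply: ord_geX.
have : (1 - D n)`_0 = 0 by rewrite coefB coef1 D0 subrr.
rewrite -horner_coef0 => /eqP /factor_theorem [E ->].
rewrite subr0 rmorphM mulrC -[iota 'X]expr1; exact: ord_ge_poly.
Qed.
End Series.

(** * Counting solutions in the cone; Hecke-type double sums *)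

(** The lower inequality is strict and the upper one is not, so that each orbit of
    the unit on totally positive elements meets the cone exactly once. *)
Definition sol (d N : int) (uv : int * int) : bool :=
  (uv.1 ^+ 2 - d * uv.2 ^+ 2 == N) && ((- uv.1 < d * uv.2) && (d * uv.2 <= uv.1)).

Definition counted (P : pred (int * int)) (m : nat) : Prop :=
  exists s : seq (int * int), [/\ uniq s, s =i P & size s = m].

Lemma int_mod (d : nat) (u : int) : (0 < d)%N ->
  exists a (t : nat), u = d%:Z * a + t%:Z /\ (t < d)%N.
Proof.
move=> d0; exists (u %/ d%:Z)%Z, (absz (u %% d%:Z)%Z).
have h1 := divz_eq u d%:Z.
have h2 := modz_ge0 u (_ : d%:Z != 0); have h3 := ltz_pmod u (_ : 0 < d%:Z).
by split; [rewrite gez0_abs ?h2 //; [rewrite {1}h1; ring | lia] | have := h2; have := h3; lia].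
Qed.

Lemma sol_iff d N u v : sol d N (u, v) <->
  u * u - d * (v * v) = N /\ - u < d * v <= u.
Proof.
rewrite /sol /= !expr2; split=> [/andP[/eqP-> ->] //|[-> ->]].
by rewrite eqxx.
Qed.

Definition sym_range (r : nat) : seq int := [seq i%:Z - r%:Z | i <- iota 0 (2 * r + 1)].
Definition parity_range (r : nat) : seq int := [seq (2 * i)%:Z - r%:Z | i <- iota 0 r.+1].

Lemma mem_sym_range r j : (j \in sym_range r) = (- r%:Z <= j <= r%:Z).
Proof.
apply/mapP/idP => [[i]|h]; first by rewrite mem_iota => hi ->; lia.
by exists (absz (j + r%:Z)); [rewrite mem_iota|]; lia.
Qed.

Lemma sym_range_uniq r : uniq (sym_range r).
Proof. by rewrite map_inj_uniq ?iota_uniq // => i j; lia. Qed.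

Lemma mem_parity_range r j :
  (j \in parity_range r) = (- r%:Z <= j <= r%:Z) && (absz (j + r%:Z)%R %% 2 == 0)%N.
Proof.
apply/mapP/idP => [[i]|h]; first by rewrite mem_iota => hi ->; lia.
by exists (absz (j + r%:Z)%R %/ 2)%N; [rewrite mem_iota|]; lia.
Qed.

Lemma parity_range_uniq r : uniq (parity_range r).
Proof. by rewrite map_inj_uniq ?iota_uniq // => i j; lia. Qed.

Lemma big_sym_rangeS (V : zmodType) (F : int -> V) r :
  \sum_(j <- sym_range r.+1) F j = F (- r.+1%:Z) + F r.+1%:Z + \sum_(j <- sym_range r) F j.
Proof.
rewrite (perm_big [:: - r.+1%:Z, r.+1%:Z & sym_range r]).
  by rewrite !big_cons /= addrA.
apply: uniq_perm; rewrite ?sym_range_uniq //.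
  rewrite 2!cons_uniq sym_range_uniq in_cons !mem_sym_range; lia.
by move=> j; rewrite mem_sym_range 2!in_cons mem_sym_range; apply/idP/idP; lia.
Qed.

Lemma big_parity_rangeSS (V : zmodType) (F : int -> V) r :
  \sum_(j <- parity_range r.+2) F j = F (- r.+2%:Z) + F r.+2%:Z + \sum_(j <- parity_range r) F j.
Proof.
rewrite (perm_big [:: - r.+2%:Z, r.+2%:Z & parity_range r]).
  by rewrite !big_cons /= addrA.
apply: uniq_perm; rewrite ?parity_range_uniq //.
  rewrite 2!cons_uniq parity_range_uniq in_cons !mem_parity_range; lia.
by move=> j; rewrite mem_parity_range 2!in_cons mem_parity_range; apply/idP/idP; lia.
Qed.

Definition hecke_sum (bs : seq bool) (N : nat) (R : nat -> seq int)
  (sg : bool -> nat -> int -> int) (E : bool -> nat -> int -> nat) : {poly int} :=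
  \sum_(b <- bs) \sum_(r < N.+1) \sum_(j <- R r) sg b r j *: 'X^(E b r j).

(** The monomials with exponent k of a double sum, indexed by (b, r, j), become the
    solutions of one equation u^2 - d v^2 = M when UV is an injective
    parametrization of them; the flag b distinguishes the residue classes of u. *)
Lemma hecke_sum_coef bs N R sg E (UV : bool -> nat -> int -> int * int) d M (c : int) k :
  uniq bs -> (forall r, uniq (R r)) ->
  (forall b r j b' r' j', b \in bs -> b' \in bs -> j \in R r -> j' \in R r' -> UV b r j = UV b' r' j' ->
     [/\ b = b', r = r' & j = j']) ->
  (forall b r j, j \in R r -> E b r j = k -> sol d M (UV b r j) /\ sg b r j = c) ->
  (forall u v, sol d M (u, v) -> exists b r j,
     [/\ b \in bs, (r <= N)%N, j \in R r, E b r j = k & UV b r j = (u, v)]) ->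
  exists2 m, counted (sol d M) m & (hecke_sum bs N R sg E)`_k = c * m%:Z.
Proof.
move=> ubs uR injUV hE hsol.
pose ind : seq (bool * nat * int) :=
  [seq (br, j) | br <- [seq (b, r) | b <- bs, r <- iota 0 N.+1], j <- R br.2].
have uind : uniq ind.
  apply: allpairs_uniq_dep => //; first by apply: allpairs_uniq => //; [exact: iota_uniq | case=> ? ? []].
  by move=> [br j] [br' j'] _ _ /= [-> ->].
have mem_ind b r j : ((b, r, j) \in ind) = [&& b \in bs, (r <= N)%N & j \in R r].
  apply/allpairsPdep/and3P => [|[hb hr hj]].
    move=> [[b' r'] [j' [/allpairsP[[b0 r0] [hb hr [eb er]]] hj [-> -> ->]]]].
    move: hb hr hj; rewrite mem_iota -eb -er /= => hb hr hj; split => //.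
  exists (b, r), j; split => //; apply/allpairsP; exists (b, r); split => //.
  by rewrite mem_iota.
pose f (i : bool * nat * int) := UV i.1.1 i.1.2 i.2.
pose s := [seq f i | i <- ind & E i.1.1 i.1.2 i.2 == k].
have size_s : size s = count (fun i : bool * nat * int => E i.1.1 i.1.2 i.2 == k) ind.
  by rewrite size_map size_filter.
exists (size s).
  exists s; split => //.
    rewrite map_inj_in_uniq ?filter_uniq //.
    move=> [[b r] j] [[b' r'] j']; rewrite !mem_filter !mem_ind.
    by move=> /andP[_ /and3P[hb _ hj]] /andP[_ /and3P[hb' _ hj']] /injUV[] //= -> -> ->.
  move=> [u v]; apply/mapP/idP => [[[[b r] j]]|].
    rewrite mem_filter mem_ind => /andP[/= /eqP Ek /and3P[_ _ hj]] ->.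
    by have [] := hE b r j hj Ek.
  move=> /hsol [b [r [j [hb hr hj Ek UVe]]]]; exists (b, r, j) => //.
  by rewrite mem_filter /= Ek eqxx mem_ind hb hr.
have -> : hecke_sum bs N R sg E = \sum_(i <- ind) sg i.1.1 i.1.2 i.2 *: 'X^(E i.1.1 i.1.2 i.2).
  rewrite /hecke_sum big_allpairs_dep big_allpairs_dep; apply: eq_bigr => b _.
  have -> : iota 0 N.+1 = index_iota 0 N.+1 by rewrite /index_iota subn0.
  by rewrite big_mkord.
rewrite coef_sum size_s -sum1_count -natz natr_sum mulr_sumr [in RHS]big_mkcond /=.
rewrite big_seq [in RHS]big_seq; apply: eq_bigr => -[[b r] j]; rewrite mem_ind /=.
move=> /and3P[_ _ hj]; rewrite coefZ coefXn eq_sym; case: eqP => [Ek|_]; last by rewrite mulr0.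
by have [_ ->] := hE b r j hj Ek.
Qed.

(** * The coefficients of f5 *)

Section CoefficientF5.
Variables (L : fieldType) (iota : {rmorphism {poly int} -> L}).
Hypothesis iota_inj : injective iota.
Local Notation x := (iota 'X).

Lemma iota_qpoch a Q n : iota (qpoch a Q n) = poch (iota a) (iota Q) n.
Proof.
rewrite rmorph_prod; apply: eq_bigr => i _.
by rewrite rmorphB rmorph1 rmorphM rmorphXn.
Qed.

Lemma one_sub_x_neq0 k : 1 - x ^+ k.+1 != 0.
Proof. by apply: (base_neq0 iota_inj (Q := x)); exact: (ord_ge_Xn iota 1). Qed.

(** The common pattern of all evaluations: the n-th term is c delta_n beta_n, and
    c alpha_r gamma_r is a sum of signed monomials. Truncating at k+1 leaves an
    error of order k+1, which does not reach the coefficient of x^k. *)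
Lemma series_coef (Nu De : nat -> {poly int}) (Q z c : L) s (alpha beta : nat -> L)
    bs R sg E k :
  (forall n, (De n)`_0 = 1) -> ord_ge iota 1 Q -> ord_ge iota 1 z -> ord_ge iota 0 c ->
  (forall n, iota (Nu n) / iota (De n) = c * (delta Q z s n * beta n)) ->
  (forall r, ord_ge iota 0 (alpha r)) ->
  (forall n, \sum_(r < n.+1) alpha r * weight Q s.+1 n r = beta n) ->
  (forall r, c * (alpha r * gamma Q z s r) =
     \sum_(b <- bs) \sum_(j <- R r) iota (sg b r j *: 'X^(E b r j))) ->
  \sum_(n < k.+2) fps_div (Nu n) (De n) k = (hecke_sum bs k.+1 R sg E)`_k.
Proof.
move=> D0 Q1 z1 c0 tE ra ab gE.
apply: (fps_div_sum iota_inj (K := k.+1)) => //.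
have -> : iota (hecke_sum bs k.+1 R sg E) = c * \sum_(r < k.+2) alpha r * gamma Q z s r.
  rewrite /hecke_sum exchange_big /= rmorph_sum mulr_sumr; apply: eq_bigr => r _.
  by rewrite gE rmorph_sum; apply: eq_bigr => b _; rewrite rmorph_sum.
rewrite (eq_bigr (fun n : 'I_k.+2 => c * (delta Q z s n * beta n))); last by move=> n _; rewrite tE.
rewrite -mulr_sumr -mulrBr; apply: (ord_geMl iota_inj) => //.
exact: (bailey_lemma iota_inj Q1 z1 ra ab).
Qed.

Lemma regular_x k : ord_ge iota 0 (x ^+ k).
Proof. by apply: (regularX iota_inj); apply: regular_poly. Qed.

Lemma regular_sign k : ord_ge iota 0 ((-1) ^+ k).
Proof. by apply: (regularX iota_inj); apply: ord_geN; exact: regular1. Qed.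

Lemma regular_sum (a : int -> L) (e : int -> nat) l : (forall j, ord_ge iota 0 (a j)) ->
  ord_ge iota 0 (\sum_(j <- l) a j * x ^+ e j).
Proof.
move=> ha; apply: (ord_ge_sum iota_inj) => j; apply: (ord_geMl iota_inj) => //.
exact: regular_x.
Qed.

Lemma sym_range_rec (a : int -> L) (e : nat -> int -> nat) u c1 c2 r :
  (forall j, - r%:Z <= j <= r%:Z -> e r.+1 j = (u + e r j)%N) ->
  e r.+1 (- r.+1%:Z) = c1 -> e r.+1 r.+1%:Z = c2 ->
  \sum_(j <- sym_range r.+1) a j * x ^+ e r.+1 j =
  x ^+ u * (\sum_(j <- sym_range r) a j * x ^+ e r j) +
    (a (- r.+1%:Z) * x ^+ c1 + a r.+1%:Z * x ^+ c2).
Proof.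
move=> he <- <-; rewrite big_sym_rangeS addrC mulr_sumr; congr (_ + _).
rewrite big_seq [RHS]big_seq; apply: eq_bigr => j; rewrite mem_sym_range => hj.
by rewrite he // exprD mulrCA.
Qed.

Lemma parity_range_rec (y : L) (e : nat -> int -> nat) u c r :
  (forall j, - r%:Z <= j <= r%:Z -> e r.+2 j = (u + e r j)%N) ->
  e r.+2 (- r.+2%:Z) = c -> e r.+2 r.+2%:Z = c ->
  \sum_(j <- parity_range r.+2) y ^+ e r.+2 j =
  y ^+ u * (\sum_(j <- parity_range r) y ^+ e r j) + y ^+ c *+ 2.
Proof.
move=> he h1 h2; rewrite big_parity_rangeSS h1 h2 -mulr2n addrC mulr_sumr; congr (_ + _).
rewrite big_seq [RHS]big_seq; apply: eq_bigr => j; rewrite mem_parity_range => /andP[hj _].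
by rewrite he // exprD.
Qed.

Lemma poch_zero Q n : poch (0 : L) Q n = 1.
Proof. by rewrite /poch big1 // => i _; rewrite mul0r subr0. Qed.

Lemma zpow_zero Q n : zpow Q (0 : L) 0 n = (-1) ^+ n * Q ^+ 'C(n.+1, 2).
Proof.
elim: n => [|n IH]; first by rewrite /zpow big_ord0 mul1r.
by rewrite zpowS IH add1n ['C(n.+2, 2)]binS bin1 exprD [(-1) ^+ n.+1]exprS sub0r; ring.
Qed.

(** Division-free form of the triangular numbers, for linear arithmetic. *)
Lemma triangular n : ('C(n.+1, 2) * 2 = n * n.+1)%N.
Proof. by elim: n => // n IH; rewrite binS bin1 mulnDl IH; lia. Qed.

Lemma half_sq_add n : ((n ^ 2 + n) %/ 2 = 'C(n.+1, 2))%N.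
Proof. by have := triangular n; rewrite expnS expn1; lia. Qed.

Definition exp_f5 (r : nat) (j : int) : nat :=
  (absz (2 * (r%:Z * r%:Z) + 2 * r%:Z - j * j - j)%R %/ 2)%N.

Lemma sqr_le_sym (r : nat) (j : int) : - r%:Z <= j <= r%:Z -> j * j <= r%:Z * r%:Z.
Proof. by move=> h; nia. Qed.

Lemma pronic_le_sym (r : nat) (j : int) : - r%:Z <= j <= r%:Z -> j * j + j <= r%:Z * r%:Z + r%:Z.
Proof. by move=> h; nia. Qed.

Lemma coef_f5 k : f5 k = (hecke_sum [:: false] k.+1 sym_range (fun _ _ _ => 1)
  (fun _ r j => ('C(r.+1, 2) + exp_f5 r j)%N))`_k.
Proof.
rewrite /f5 (fps_sum_trunc (M := k.+2)) //; last first.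
  by move=> n _ /terms_low[_ []].
rewrite big_mkord.
pose T r := (-1) ^+ r * \sum_(j <- sym_range r) 1 * x ^+ exp_f5 r j.
apply: (@series_coef (fun n => (- 1) ^+ n * qpoch 'X 'X n * 'X ^+ ((n ^ 2 + n) %/ 2))
  (fun n => qpoch 'X ('X ^+ 2) (n + 1)) x 0 1 0 (fun r => 1 * T r)
  (fun n => (poch x (x ^+ 2) n.+1)^-1)).
- by move=> n; apply: qpoch_coef0; rewrite coefX.
- exact: (ord_ge_Xn iota 1).
- exact: ord_ge_zero.
- exact: regular1.
- move=> n; rewrite !rmorphM !rmorphXn rmorphN rmorph1 !iota_qpoch rmorphXn /= addn1.
  by rewrite /delta zpow_zero half_sq_add mul1r; ring.
- move=> r; rewrite mul1r; apply: (ord_geMl iota_inj); first exact: regular_sign.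
  by apply: regular_sum => j; exact: regular1.
- apply: (bailey_pair_f5 one_sub_x_neq0 (x_neq0 iota_inj)).
    by rewrite /T expr0 mul1r big_seq1 mul1r.
  move=> r; rewrite /T (@sym_range_rec (fun=> 1) exp_f5 (2 * r + 2) ('C(r.+2, 2) + r.+1) 'C(r.+2, 2)).
  - by rewrite exprS; ring.
  - by move=> j hj; have := pronic_le_sym hj; rewrite /exp_f5; lia.
  - by have := triangular r.+1; rewrite /exp_f5; lia.
  - by have := triangular r.+1; rewrite /exp_f5; lia.
move=> r; rewrite big_seq1 /gamma poch_zero zpow_zero addn0 mulr1 !mul1r /T.
have -> : poch x x r * ((-1) ^+ r * x ^+ 'C(r.+1, 2)) / poch x x r = (-1) ^+ r * x ^+ 'C(r.+1, 2).
  by have h := poch_neq0 one_sub_x_neq0 r; field.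
rewrite mulrACA -expr2 sqrr_sign mul1r mulr_suml.
by apply: eq_bigr => j _; rewrite scale1r rmorphXn /= exprD mul1r mulrC.
Qed.

(** The exponent of the double sum satisfies
    8 E + 2 = 3 (2r+1)^2 - (2j+1)^2, and conversely a solution with right-hand
    side 3 (8k+2) has u = 3 (2r+1) and v odd, by congruences modulo 3 and 8. *)
Lemma f5_count k : exists2 m, counted (sol 3 (3 * (8 * k%:Z + 2))) m & f5 k = m%:Z.
Proof.
suff [m hm e] : exists2 m, counted (sol 3 (3 * (8 * k%:Z + 2))) m & f5 k = 1 * m%:Z.
  by exists m => //; rewrite e mul1r.
rewrite coef_f5.
apply: (hecke_sum_coef (UV := fun _ r j => (3 * (2 * r%:Z + 1), 2 * j + 1))) => //.
- exact: sym_range_uniq.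
- by move=> b r j b' r' j'; rewrite !inE => /eqP-> /eqP-> _ _ []; split => //; lia.
- move=> _ r j; rewrite mem_sym_range => hj Ek; split => //; apply/sol_iff; split; last lia.
  have [a [t [ej t2]]] := @int_mod 2 j isT.
  have := pronic_le_sym hj; have := triangular r; move: Ek hj; rewrite /exp_f5 ej.
  case: t t2 ej => [|[|t]] // _ ej; set C := 'C(_, _) => *.
    lia.
  lia.
move=> u v /sol_iff[e1 e2].
have [a [t [eu t3]]] := @int_mod 3 u isT.
case: t eu t3 => [|[|[|t]]] // eu _; rewrite eu in e1 e2; [|lia|lia].
have [b [t [ea t2]]] := @int_mod 2 a isT.
have [c [t' [ev t2']]] := @int_mod 2 v isT.
case: t ea t2 => [|[|t]] // ea _; case: t' ev t2' => [|[|t']] // ev _; rewrite ea ev in e1 e2; [lia|lia|lia|].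
have a0 : 0 <= b by lia.
exists false, (absz b), c; rewrite inE mem_sym_range; split => //.
- by nia.
- by lia.
- have := triangular (absz b); rewrite /exp_f5; set C := 'C(_, _).
  have : (absz b)%:Z = b by lia.
  move: (absz b) => n en; rewrite -en in e1 e2 *.
  have hc : - n%:Z <= c <= n%:Z by lia.
  have := pronic_le_sym hc; lia.
- by congr (_, _); lia.
Qed.
End CoefficientF5.

(** * The coefficients of f3 and f7 *)

Section CoefficientsF3F7.
Variables (L : fieldType) (iota : {rmorphism {poly int} -> L}).
Hypothesis iota_inj : injective iota.
Local Notation x := (iota 'X).

Lemma sign_parity (R : pzRingType) n m : (n %% 2 = m %% 2)%N -> (-1) ^+ n = (-1) ^+ m :> R.
Proof. by rewrite !modn2 => e; rewrite -signr_odd -[RHS]signr_odd; move: e; do 2 case: odd. Qed.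

Lemma iota_monomial n e : iota ((-1) ^+ n *: 'X^e) = (-1) ^+ n * x ^+ e.
Proof.
by rewrite -mul_polyC rmorphXn /= polyCN rmorphM !rmorphXn rmorphN /= !rmorph1.
Qed.

Lemma zpow_x n : zpow (x ^+ 2) x 0 n = x ^+ n * poch x (x ^+ 2) n.
Proof.
elim: n => [|n IH]; first by rewrite /zpow big_ord0 poch0 mulr1.
by rewrite zpowS IH pochS add1n -!exprM mulnS exprD [x ^+ n.+1]exprS; ring.
Qed.

Lemma poch_even n : poch x x (2 * n) = poch x (x ^+ 2) n * poch (x ^+ 2) (x ^+ 2) n.
Proof.
elim: n => [|n IH]; first by rewrite muln0 !poch0 mulr1.
have -> : (2 * n.+1 = (2 * n).+2)%N by lia.
by rewrite !pochS IH -!exprM !exprS; ring.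
Qed.

Lemma poch_x_neq0 n : poch x (x ^+ 2) n != 0.
Proof.
elim: n => [|n IH]; first by rewrite poch0 oner_neq0.
by rewrite pochS mulf_neq0 // -exprM -exprS one_sub_x_neq0.
Qed.

Lemma gamma_x r : gamma (x ^+ 2) x 0 r = x ^+ r / (1 - x ^+ (2 * r + 1)).
Proof.
rewrite /gamma zpow_x addn0 pochS.
have -> : x * (x ^+ 2) ^+ r = x ^+ (2 * r + 1) by rewrite -exprM -exprS addn1.
have h1 := poch_x_neq0 r; have h2 := poch_neq0 (one_sub_sqr_exp_neq0 (one_sub_x_neq0 iota_inj)) r.
have h3 : 1 - x ^+ (2 * r + 1) != 0 by rewrite addn1 one_sub_x_neq0.
by field; rewrite h1 h2 h3.
Qed.

Definition exp_f7 (r : nat) (j : int) : nat := absz (2 * (r%:Z * r%:Z) + r%:Z - j * j)%R.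

Definition inner_f7 r : L := \sum_(j <- sym_range r) (-1) ^+ absz j * x ^+ exp_f7 r j.

Lemma bailey_pair_f7_x n : \sum_(r < n.+1) (1 - x ^+ (2 * r + 1)) * inner_f7 r * weight (x ^+ 2) 1 n r =
    (poch (- x) x (2 * n + 1))^-1.
Proof.
apply: (bailey_pair_f7 (one_sub_x_neq0 iota_inj) (x_neq0 iota_inj)).
  by rewrite /inner_f7 big_seq1 mul1r.
move=> r; rewrite /inner_f7 (@sym_range_rec _ _ (fun j => (-1) ^+ absz j) exp_f7 (4 * r + 3) (2 * 'C(r.+2, 2)) (2 * 'C(r.+2, 2))).
- by rewrite abszN absz_nat -exprM; ring.
- by move=> j hj; have := sqr_le_sym hj; rewrite /exp_f7; lia.
- by have := triangular r.+1; rewrite /exp_f7; lia.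
- by have := triangular r.+1; rewrite /exp_f7; lia.
Qed.

Lemma regular_alpha_f7 r : ord_ge iota 0 ((1 - x ^+ (2 * r + 1)) * inner_f7 r).
Proof.
apply: (ord_geMl iota_inj); first by apply: (ord_geB iota_inj); [exact: regular1 | exact: regular_x].
by apply: (regular_sum iota_inj) => j; exact: regular_sign.
Qed.

Lemma ord_ge_x2 : ord_ge iota 1 (x ^+ 2).
Proof. by apply: (ord_geW (l := 2)) => //; exact: ord_ge_Xn. Qed.

Lemma ord_ge_x : ord_ge iota 1 x.
Proof. exact: (ord_ge_Xn iota 1). Qed.

Lemma coef_f3 k : f3 k = (hecke_sum [:: false] k.+1 sym_range (fun _ _ j => (-1) ^+ absz j)
  (fun _ r j => (r + exp_f7 r j)%N))`_k.
Proof.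
rewrite /f3 (fps_sum_trunc (M := k.+2)) //; last by move=> n _ /terms_low[[]].
rewrite big_mkord.
apply: (@series_coef _ _ iota_inj (fun n => qpoch 'X 'X (2 * n) * 'X ^+ n)
  (fun n => qpoch (- 'X) 'X (2 * n + 1)) (x ^+ 2) x 1 0 _ _ _ _ _ _ _ _ _ _ _ _ regular_alpha_f7 bailey_pair_f7_x).
- by move=> n; apply: qpoch_coef0; rewrite coefN coefX oppr0.
- exact: ord_ge_x2.
- exact: ord_ge_x.
- exact: regular1.
- move=> n; rewrite !rmorphM !rmorphXn !iota_qpoch rmorphN /=.
  by rewrite /delta zpow_x poch_even; ring.
move=> r; rewrite big_seq1 gamma_x mul1r /inner_f7.
have h3 : 1 - x ^+ (2 * r + 1) != 0 by rewrite addn1 one_sub_x_neq0.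
transitivity (x ^+ r * inner_f7 r); first by rewrite /inner_f7; field.
rewrite mulr_sumr; apply: eq_bigr => j _.
by rewrite iota_monomial exprD mulrCA.
Qed.

(** The exponent E = 2r^2 + 2r - j^2 has the parity of j, so the sign is (-1)^k,
    and 2 E + 1 = (2r+1)^2 - 2 j^2. *)
Lemma f3_count k : exists2 m, counted (sol 2 (2 * k%:Z + 1)) m & f3 k = (-1) ^+ k * m%:Z.
Proof.
rewrite coef_f3.
apply: (hecke_sum_coef (UV := fun _ r j => (2 * r%:Z + 1, j))) => //.
- exact: sym_range_uniq.
- by move=> b r j b' r' j'; rewrite !inE => /eqP-> /eqP-> _ _ []; split => //; lia.
- move=> _ r j; rewrite mem_sym_range => hj Ek; split => /=.
    by apply/sol_iff; have := sqr_le_sym hj; rewrite /exp_f7 in Ek; split; lia.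
  apply: sign_parity; move: Ek (sqr_le_sym hj); rewrite /exp_f7.
  have [a [t [ej t2]]] := @int_mod 2 j isT.
  rewrite ej; case: t t2 ej => [|[|t]] // _ ej; lia.
move=> u v /sol_iff[e1 e2].
have [a [t [eu t3]]] := @int_mod 2 u isT.
case: t eu t3 => [|[|t]] // eu _; rewrite eu in e1 e2; [lia|].
have a0 : 0 <= a by lia.
exists false, (absz a), v; rewrite inE mem_sym_range; split => //.
- by nia.
- by lia.
- have : (absz a)%:Z = a by lia.
  move: (absz a) => n en; rewrite -en in e1 e2 *.
  have hc : - n%:Z <= v <= n%:Z by lia.
  have := sqr_le_sym hc; rewrite /exp_f7; lia.
- by congr (_, _); lia.
Qed.

Lemma coef_f7 k : f7 k = (hecke_sum [:: false; true] k.+1 sym_range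
  (fun b r j => (-1) ^+ (b + r + absz j))
  (fun b r j => (2 * 'C(r.+1, 2) + exp_f7 r j + b * (2 * r + 1))%N))`_k.
Proof.
rewrite /f7 (fps_sum_trunc (M := k.+2)) //; last by move=> n _ /terms_low[_ []].
rewrite big_mkord.
apply: (@series_coef _ _ iota_inj
  (fun n => (- 1) ^+ n * ('X ^+ (n ^ 2 + n) * qpoch ('X ^+ 2) ('X ^+ 2) n))
  (fun n => qpoch (- 'X) 'X (2 * n + 1)) (x ^+ 2) 0 1 0 _ _ _ _ _ _ _ _ _ _ _ _ regular_alpha_f7 bailey_pair_f7_x).
- by move=> n; apply: qpoch_coef0; rewrite coefN coefX oppr0.
- exact: ord_ge_x2.
- exact: ord_ge_zero.
- exact: regular1.
- move=> n; rewrite !rmorphM !rmorphXn !iota_qpoch !rmorphN rmorph1 rmorphXn /=.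
  rewrite /delta zpow_zero -exprM.
  have -> : (2 * 'C(n.+1, 2) = n ^ 2 + n)%N by have := triangular n; rewrite expnS expn1; lia.
  by ring.
move=> r; rewrite big_cons big_seq1 /gamma poch_zero zpow_zero addn0 mulr1 mul1r -exprM.
have -> : poch (x ^+ 2) (x ^+ 2) r * ((-1) ^+ r * x ^+ (2 * 'C(r.+1, 2))) / poch (x ^+ 2) (x ^+ 2) r = (-1) ^+ r * x ^+ (2 * 'C(r.+1, 2)).
  by have h := poch_neq0 (one_sub_sqr_exp_neq0 (one_sub_x_neq0 iota_inj)) r; field.
rewrite mulrC mulrA mulr_sumr -big_split /=; apply: eq_bigr => j _.
rewrite !iota_monomial add0n mul0n addn0 mul1n.
by rewrite !exprD expr1; ring.
Qed.

(** The two monomials of 1 - x^(2r+1) give u = 3r+1 and u = 3r+2, all residues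
    that are possible modulo 3. *)
Lemma f7_count k : exists2 m, counted (sol 3 (3 * k%:Z + 1)) m & f7 k = (-1) ^+ k * m%:Z.
Proof.
rewrite coef_f7.
apply: (hecke_sum_coef (UV := fun b r j => (3 * r%:Z + 1 + b%:Z, j))) => //.
- exact: sym_range_uniq.
- move=> b r j b' r' j' _ _ _ _ [] e ->; split => //; last lia.
  by move: e; case: b; case: b'; lia.
- move=> b r j; rewrite mem_sym_range => hj Ek; split => /=.
    apply/sol_iff; have := sqr_le_sym hj; have := triangular r; rewrite /exp_f7 in Ek; move: Ek.
    by case: b; set C := 'C(_, _); rewrite ?mul1n ?mul0n; split; lia.
  apply: sign_parity; move: Ek (sqr_le_sym hj) (triangular r); rewrite /exp_f7; set C := 'C(_, _).
  have [a [t [ej t2]]] := @int_mod 2 j isT.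
  have [c [t' [er t2']]] := @int_mod 2 r isT.
  have [c' ec'] : exists c' : nat, c = c'%:Z by exists (absz c); lia.
  have er' : r = (2 * c' + t')%N by lia.
  rewrite ej er'; case: t t2 ej => [|[|t]] // _ ej; case: t' t2' {er er'} => [|[|t']] // _;
    case: b; rewrite ?mul1n ?mul0n /=; lia.
move=> u v /sol_iff[e1 e2].
have [a [t [eu t3]]] := @int_mod 3 u isT.
have a0 : 0 <= a by lia.
have ea : (absz a)%:Z = a by lia.
move: (absz a) ea => n en; rewrite -en in eu.
case: t eu t3 => [|[|[|t]]] // eu _; rewrite eu in e1 e2; [lia| |].
- exists false, n, v; rewrite mem_sym_range.
  have hc : - n%:Z <= v <= n%:Z by lia.
  have := sqr_le_sym hc; have := triangular n; set C := 'C(_, _); split => //.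
  + by nia.
  + by rewrite /exp_f7; lia.
  + by congr (_, _); lia.
- exists true, n, v; rewrite mem_sym_range.
  have hc : - n%:Z <= v <= n%:Z by lia.
  have := sqr_le_sym hc; have := triangular n; set C := 'C(_, _); split => //.
  + by nia.
  + by rewrite /exp_f7 mul1n; lia.
  + by congr (_, _); lia.
Qed.

End CoefficientsF3F7.

(** * The coefficients of f4 *)

Section OddBase.
Variables (L : fieldType) (iota : {rmorphism {poly int} -> L}).
Hypothesis iota_inj : injective iota.
Local Notation x := (iota 'X).

Lemma zpow_x1 n : (1 - x) * zpow (x ^+ 2) x 1 n = x ^+ n * poch x (x ^+ 2) n.+1.
Proof.
elim: n => [|n IH]; first by rewrite /zpow big_ord0 pochS poch0; ring.
rewrite zpowS mulrA IH [in RHS]pochS add2n -!exprM mulnS exprD [x ^+ n.+1]exprS.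
have -> : (2 * n.+1 = (2 * n).+2)%N by lia.
by rewrite !exprS; ring.
Qed.

Lemma delta_x1 n : x * (1 - x) * delta (x ^+ 2) x 1 n = poch x x (2 * n + 1) * x ^+ (n + 1).
Proof.
rewrite /delta.
have -> : x * (1 - x) * (poch (x ^+ 2) (x ^+ 2) n * zpow (x ^+ 2) x 1 n) =
  x * poch (x ^+ 2) (x ^+ 2) n * ((1 - x) * zpow (x ^+ 2) x 1 n) by ring.
by rewrite zpow_x1 !addn1 [in RHS]pochS poch_even pochS -!exprM !exprS; ring.
Qed.

Lemma gamma_x1 r : x * (1 - x) * gamma (x ^+ 2) x 1 r = x ^+ r.+1 / (1 - x ^+ (2 * r + 2)).
Proof.
rewrite /gamma addn1 [poch (x ^+ 2) _ r.+1]pochS.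
have -> : x ^+ 2 * (x ^+ 2) ^+ r = x ^+ (2 * r + 2) by rewrite -exprM -exprD addnC.
have h1 := poch_x_neq0 iota_inj r.+1; have h2 := poch_neq0 (one_sub_sqr_exp_neq0 (one_sub_x_neq0 iota_inj)) r.
have h3 : 1 - x ^+ (2 * r + 2) != 0 by rewrite addn2 one_sub_x_neq0.
transitivity (x * poch (x ^+ 2) (x ^+ 2) r * ((1 - x) * zpow (x ^+ 2) x 1 r) /
  (poch (x ^+ 2) (x ^+ 2) r * (1 - x ^+ (2 * r + 2)) * poch x (x ^+ 2) r.+1)).
  by field; rewrite h1 h2 h3.
by rewrite zpow_x1 [x ^+ r.+1]exprS; field; rewrite h1 h2 h3.
Qed.

Lemma regular_prefactor : ord_ge iota 0 (x * (1 - x)).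
Proof.
apply: (ord_geMl iota_inj); first exact: (regular_x iota_inj 1).
by apply: (ord_geB iota_inj); [exact: regular1 | exact: (regular_x iota_inj 1)].
Qed.

End OddBase.

Definition initial_range (r : nat) : seq int := [seq i%:Z | i <- iota 0 r.+1].

Lemma mem_initial_range r j : (j \in initial_range r) = (0 <= j <= r%:Z).
Proof.
apply/mapP/idP => [[i]|h]; first by rewrite mem_iota => hi ->; lia.
by exists (absz j); [rewrite mem_iota|]; lia.
Qed.

Lemma initial_range_uniq r : uniq (initial_range r).
Proof. by rewrite map_inj_uniq ?iota_uniq // => i j; lia. Qed.

Lemma big_initial_rangeS (V : zmodType) (F : int -> V) r :
  \sum_(j <- initial_range r.+1) F j = \sum_(j <- initial_range r) F j + F r.+1%:Z.
Proof. by rewrite /initial_range -[r.+2]addn1 iotaD map_cat big_cat /= big_seq1. Qed.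

Definition exp_f4 (r : nat) (j : int) : nat :=
  absz (2 * (r%:Z * r%:Z) + 3 * r%:Z - j * j - 2 * j)%R.
Definition exp_f4_next (r : nat) (j : int) : nat :=
  absz (2 * (r%:Z * r%:Z) + 3 * r%:Z - j * j + 1)%R.

Lemma sqr_le_initial (r : nat) (j : int) : 0 <= j <= r%:Z -> j * j <= r%:Z * r%:Z.
Proof. by move=> h; nia. Qed.

Section CoefficientF4.
Variables (L : fieldType) (iota : {rmorphism {poly int} -> L}).
Hypothesis iota_inj : injective iota.
Local Notation x := (iota 'X).

Definition inner_f4 r : L := \sum_(j <- initial_range r) (-1) ^+ absz j * (x ^+ exp_f4 r j - x ^+ exp_f4_next r j).

Lemma inner_f4S r : inner_f4 r.+1 = x ^+ (4 * r + 5) * inner_f4 r +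
     (-1) ^+ r.+1 * (1 - x ^+ (2 * r + 3)) * (x ^+ 2) ^+ 'C(r.+2, 2).
Proof.
rewrite /inner_f4 big_initial_rangeS mulr_sumr; congr (_ + _).
  rewrite big_seq [RHS]big_seq; apply: eq_bigr => j; rewrite mem_initial_range => hj.
  have h := sqr_le_initial hj.
  have -> : exp_f4 r.+1 j = (4 * r + 5 + exp_f4 r j)%N by rewrite /exp_f4; lia.
  have -> : exp_f4_next r.+1 j = (4 * r + 5 + exp_f4_next r j)%N by rewrite /exp_f4_next; lia.
  by rewrite !exprD; ring.
rewrite -exprM.
have -> : exp_f4 r.+1 r.+1%:Z = (2 * 'C(r.+2, 2))%N by have := triangular r.+1; rewrite /exp_f4; lia.
have -> : exp_f4_next r.+1 r.+1%:Z = (2 * r + 3 + 2 * 'C(r.+2, 2))%N.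
  by have := triangular r.+1; rewrite /exp_f4_next; lia.
by rewrite absz_nat exprD; ring.
Qed.

Lemma bailey_pair_f4_x n : \sum_(r < n.+1) (1 - x ^+ (2 * r + 2)) * inner_f4 r * weight (x ^+ 2) 2 n r =
    (poch (- x) x (2 * n + 2))^-1.
Proof.
apply: (bailey_pair_f4 (one_sub_x_neq0 iota_inj) (x_neq0 iota_inj)); last exact: inner_f4S.
by rewrite /inner_f4 big_seq1 mul1r.
Qed.

Lemma regular_alpha_f4 r : ord_ge iota 0 ((1 - x ^+ (2 * r + 2)) * inner_f4 r).
Proof.
apply: (ord_geMl iota_inj); first by apply: (ord_geB iota_inj); [exact: regular1 | exact: regular_x].
apply: (ord_ge_sum iota_inj) => j; apply: (ord_geMl iota_inj); first exact: regular_sign.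
by apply: (ord_geB iota_inj); exact: regular_x.
Qed.

Lemma coef_f4 k : f4 k = (hecke_sum [:: false; true] k.+1 initial_range
  (fun b r j => (-1) ^+ (b + absz j))
  (fun b r j => (r.+1 + if b then exp_f4_next r j else exp_f4 r j)%N))`_k.
Proof.
rewrite /f4 (fps_sum_trunc (M := k.+2)) //; last by move=> n _ /terms_low[[]].
rewrite big_mkord.
apply: (@series_coef _ _ iota_inj (fun n => qpoch 'X 'X (2 * n + 1) * 'X ^+ (n + 1))
  (fun n => qpoch (- 'X) 'X (2 * n + 2)) (x ^+ 2) x (x * (1 - x)) 1 _ _ _ _ _ _ _ _ _ _ _ _ regular_alpha_f4 bailey_pair_f4_x).
- by move=> n; apply: qpoch_coef0; rewrite coefN coefX oppr0.
- exact: ord_ge_x2.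
- exact: ord_ge_x.
- exact: regular_prefactor.
- move=> n; rewrite !rmorphM !rmorphXn !iota_qpoch rmorphN /=.
  by rewrite [RHS]mulrA delta_x1.
move=> r; rewrite big_cons big_seq1 mulrCA gamma_x1 //.
have h3 : 1 - x ^+ (2 * r + 2) != 0 by rewrite addn2 one_sub_x_neq0.
transitivity (x ^+ r.+1 * inner_f4 r); first by field.
rewrite mulr_sumr -big_split /=; apply: eq_bigr => j _.
by rewrite !iota_monomial !exprD expr1; ring.
Qed.

(** The two monomials of 1 - x^(2j+1) give v = j+1 > 0 and v = -j <= 0: together
    they fill the half-open cone. *)
Lemma f4_count k : exists2 m, counted (sol 2 (2 * k%:Z)) m & f4 k = (-1) ^+ k.+1 * m%:Z.
Proof.
rewrite coef_f4.
apply: (hecke_sum_coef (UV := fun b r j => (2 * (r%:Z + 1), if b then - j else j + 1))) => //.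
- exact: initial_range_uniq.
- move=> b r j b' r' j' _ _; rewrite !mem_initial_range => hj hj' [e1 e2].
  by move: e2; case: b; case: b' => e2; split => //; lia.
- move=> b r j; rewrite mem_initial_range => hj Ek; split => /=.
    apply/sol_iff; have := sqr_le_initial hj; move: Ek; rewrite /exp_f4 /exp_f4_next.
    by case: b; split; lia.
  apply: sign_parity; move: Ek (sqr_le_initial hj); rewrite /exp_f4 /exp_f4_next.
  have [a [t [ej t2]]] := @int_mod 2 j isT.
  have [c [t' [er t2']]] := @int_mod 2 r isT.
  have [c' ec'] : exists c' : nat, c = c'%:Z by exists (absz c); lia.
  have er' : r = (2 * c' + t')%N by lia.
  by rewrite ej er'; case: t t2 ej => [|[|t]] // _ ej; case: t' t2' {er er'} => [|[|t']] // _;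
    case: b => /=; lia.
move=> u v /sol_iff[e1 e2].
have [a [t [eu t3]]] := @int_mod 2 u isT.
case: t eu t3 => [|[|t]] // eu _; rewrite eu in e1 e2; [|lia].
have [n en] : exists n : nat, a = n%:Z + 1 by exists (absz (a - 1)); lia.
rewrite en in e1 e2.
have [v0|v0] := ltP 0 v.
- have hc : 0 <= v - 1 <= n%:Z by lia.
  have hc' := sqr_le_initial hc.
  exists false, n, (v - 1); rewrite mem_initial_range; split => //.
  + by nia.
  + by rewrite /exp_f4; lia.
  + by congr (_, _); lia.
- have hc : 0 <= - v <= n%:Z by lia.
  have hc' := sqr_le_initial hc.
  exists true, n, (- v); rewrite mem_initial_range; split => //.
  + by nia.
  + by rewrite /exp_f4_next; lia.
  + by congr (_, _); lia.
Qed.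
End CoefficientF4.

(** * The coefficients of f6 and f8 *)

Definition exp_f6 (r : nat) (j : int) : nat :=
  (absz (3 * (r%:Z * r%:Z) + 2 * r%:Z - j * j)%R %/ 4)%N.

Section CoefficientsF6F8.
Variables (L : fieldType) (iota : {rmorphism {poly int} -> L}).
Hypothesis iota_inj : injective iota.
Local Notation x := (iota 'X).

Definition inner_f6 (y : L) r : L := (-1) ^+ r * \sum_(j <- parity_range r) y ^+ exp_f6 r j.

Lemma bailey_pair_f6_base (y : L) : (forall k, 1 - y ^+ k.+1 != 0) -> y != 0 ->
  forall n, \sum_(r < n.+1) (1 - y ^+ (2 * r + 2)) * inner_f6 y r * weight y 2 n r =
    poch y y n / poch y y (2 * n + 1).
Proof.
move=> hy y0; apply: bailey_pair_f6 => //.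
- by rewrite /inner_f6 big_seq1 mul1r.
- have E1 : exp_f6 1 (0 - 1) = 1%N by rewrite /exp_f6; lia.
  have E2 : exp_f6 1 (2 - 1) = 1%N by rewrite /exp_f6; lia.
  by rewrite /inner_f6 big_cons big_seq1 E1 E2 !expr1 mulN1r opprD mulr2n.
move=> r; rewrite /inner_f6 (@parity_range_rec _ y exp_f6 (3 * r + 4) 'C(r.+3, 2)).
- by rewrite !exprS; ring.
- by move=> j hj; have := sqr_le_sym hj; rewrite /exp_f6; lia.
- by have := triangular r.+2; rewrite /exp_f6; lia.
- by have := triangular r.+2; rewrite /exp_f6; lia.
Qed.

Lemma regular_alpha_f6 y r : ord_ge iota 0 y -> ord_ge iota 0 ((1 - y ^+ (2 * r + 2)) * inner_f6 y r).
Proof.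
move=> hy; apply: (ord_geMl iota_inj).
  by apply: (ord_geB iota_inj); [exact: regular1 | exact: (regularX iota_inj)].
apply: (ord_geMl iota_inj); first exact: regular_sign.
by apply: (ord_ge_sum iota_inj) => j; exact: (regularX iota_inj).
Qed.

Lemma zpow_Nx n : zpow x (- x) 1 n = (- x) ^+ n * poch (- x) x n.
Proof.
elim: n => [|n IH]; first by rewrite /zpow big_ord0 poch0 mulr1.
by rewrite zpowS IH pochS add2n [(- x) ^+ n.+1]exprS !exprS; ring.
Qed.

(** Pairs the factors 1 - y^j and 1 + y^j. *)
Lemma poch_sqr (y : L) n : poch y y n * poch (- y) y n = poch (y ^+ 2) (y ^+ 2) n.
Proof.
elim: n => [|n IH]; first by rewrite !poch0 mulr1.
by rewrite !pochS -IH exprsq; ring.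
Qed.

Lemma gamma_Nx r : - x * gamma x (- x) 1 r = - x * (- x) ^+ r / (1 - x ^+ (2 * r + 2)).
Proof.
rewrite /gamma zpow_Nx addn1 !pochS.
have -> : x ^+ (2 * r + 2) = (x * x ^+ r) ^+ 2.
  by rewrite -exprS -exprM; congr (_ ^+ _); lia.
have h1 := poch_opp_neq0 (one_sub_x_neq0 iota_inj) r; have h2 := poch_neq0 (one_sub_x_neq0 iota_inj) r.
have h3 : 1 - x * x ^+ r != 0 by rewrite -exprS one_sub_x_neq0.
have h4 : 1 + x * x ^+ r != 0 by rewrite -exprS one_add_exp_neq0 // => k; apply: one_sub_x_neq0.
field; rewrite h1 h2 h3 /= mulNr opprK h4 /=.
have -> : 1 - (x * x ^+ r) ^+ 2 = (1 - x * x ^+ r) * (1 + x * x ^+ r) by ring.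
by rewrite mulf_neq0.
Qed.

Lemma shift_sum (t : nat -> fps) k :
  (forall n, (k < n)%N -> t n k = 0) ->
  fps_sum 1 t k = \sum_(n < k.+2) t n.+1 k.
Proof.
move=> h; have kk : (k < k.+3)%N by lia.
rewrite (fps_sum_trunc _ kk); last by move=> n _; apply: h.
by rewrite big_add1 big_mkord.
Qed.

Lemma coef_f6 k : f6 k = (hecke_sum [:: false] k.+1 parity_range (fun _ _ _ => -1)
  (fun _ r j => (r.+1 + exp_f6 r j)%N))`_k.
Proof.
rewrite /f6 shift_sum; last by move=> n /terms_low[_ []].
have E n : (2 * n.+1 - 1 = 2 * n + 1)%N by lia.
rewrite /t6; under eq_bigr => n _ do rewrite E subn1 /=.
apply: (@series_coef _ _ iota_inj
  (fun n => (- 1) ^+ n.+1 * (qpoch 'X 'X n * qpoch ('X ^+ 2) ('X ^+ 2) n) * 'X ^+ n.+1)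
  (fun n => qpoch 'X 'X (2 * n + 1)) x (- x) (- x) 1 (fun r => (1 - x ^+ (2 * r + 2)) * inner_f6 x r) _ _ _ _ _ _ _ _ _ _ _ _
  (bailey_pair_f6_base (one_sub_x_neq0 iota_inj) (x_neq0 iota_inj))).
- by move=> n; apply: qpoch_coef0; rewrite coefX.
- exact: ord_ge_x.
- by apply: ord_geN; exact: ord_ge_x.
- by apply: ord_geN; exact: (regular_x iota_inj 1).
- move=> n; rewrite !rmorphM !rmorphXn !iota_qpoch rmorphN rmorph1 rmorphXn /=.
  by rewrite /delta zpow_Nx -poch_sqr [(-1) ^+ n.+1]exprS [x ^+ n.+1]exprS [(- x) ^+ n]exprNn; ring.
- by move=> r; apply: regular_alpha_f6; exact: (regular_poly iota).
move=> r; rewrite big_seq1 mulrCA gamma_Nx /inner_f6.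
have h3 : 1 - x ^+ (2 * r + 2) != 0 by rewrite addn2 one_sub_x_neq0.
transitivity (- x ^+ r.+1 * ((-1) ^+ r * (-1) ^+ r) * \sum_(j <- parity_range r) x ^+ exp_f6 r j).
  by rewrite [(- x) ^+ r]exprNn [x ^+ r.+1]exprS; field.
rewrite -expr2 sqrr_sign mulr1 mulr_sumr; apply: eq_bigr => j _.
by rewrite -[-1]expr1 iota_monomial exprD expr1; ring.
Qed.

(** The parity condition on j is implied by the equation modulo 4. *)
Lemma f6_count k : exists2 m, counted (sol 3 (3 * (4 * k%:Z - 1))) m & f6 k = - m%:Z.
Proof.
suff [m hm e] : exists2 m, counted (sol 3 (3 * (4 * k%:Z - 1))) m & f6 k = -1 * m%:Z.
  by exists m => //; rewrite e mulN1r.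
rewrite coef_f6.
apply: (hecke_sum_coef (UV := fun _ r j => (3 * (r%:Z + 1), j))) => //.
- exact: parity_range_uniq.
- by move=> b r j b' r' j'; rewrite !inE => /eqP-> /eqP-> _ _ []; split => //; lia.
- move=> _ r j; rewrite mem_parity_range => /andP[hj hp] Ek; split => //.
  apply/sol_iff; split; last lia.
  move: Ek (sqr_le_sym hj) (triangular r); rewrite /exp_f6; set C := 'C(_, _).
  have [i ei] : exists i, j = 2 * i - r%:Z.
    by exists (absz (j + r%:Z)%R %/ 2)%N%:Z; lia.
  by rewrite ei; lia.
move=> u v /sol_iff[e1 e2].
have [a [t [eu t3]]] := @int_mod 3 u isT.
case: t eu t3 => [|[|[|t]]] // eu _; rewrite eu in e1 e2; [|lia|lia].
have [n en] : exists n : nat, a = n%:Z + 1 by exists (absz (a - 1)); lia.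
rewrite en in e1 e2.
have [b [t [eb t2]]] := @int_mod 2 (v + n%:Z) isT.
have {}eb : v = 2 * b + t%:Z - n%:Z by lia.
have [c [t' [ec t2']]] := @int_mod 2 n isT.
case: t eb t2 => [|[|t]] // eb _; last first.
  by exfalso; case: t' ec t2' => [|[|t']] // ec _; rewrite ec in eb e1; rewrite eb in e1; lia.
have hc : - n%:Z <= v <= n%:Z by lia.
have hc' := sqr_le_sym hc.
exists false, n, v; rewrite mem_parity_range; split => //.
- by nia.
- by lia.
- by rewrite /exp_f6; lia.
- by congr (_, _); lia.
Qed.

Lemma poch_cat a Q m n : poch (a : L) Q (m + n) = poch a Q m * poch (a * Q ^+ m) Q n.
Proof.
elim: n => [|n IH]; first by rewrite addn0 poch0 mulr1.
by rewrite addnS !pochS IH exprD; ring.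
Qed.

Lemma coef_f8 k : f8 k = (hecke_sum [:: false; true] k.+1 parity_range (fun _ r _ => (-1) ^+ r)
  (fun b r j => (r.+1 + 2 * exp_f6 r j + b * (2 * r + 2))%N))`_k.
Proof.
rewrite /f8 shift_sum; last by move=> n /terms_low[_ []].
have E n : (2 * n.+1 - 1 = 2 * n + 1)%N by lia.
rewrite /t8; under eq_bigr => n _ do rewrite E.
apply: (@series_coef _ _ iota_inj
  (fun n => qpoch 'X 'X (2 * n + 1) * 'X ^+ n.+1)
  (fun n => qpoch ('X ^+ (2 * n.+1)) ('X ^+ 2) n.+1) (x ^+ 2) x (x * (1 - x)) 1
  (fun r => (1 - (x ^+ 2) ^+ (2 * r + 2)) * inner_f6 (x ^+ 2) r) _ _ _ _ _ _ _ _ _ _ _ _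
  (bailey_pair_f6_base (one_sub_sqr_exp_neq0 (one_sub_x_neq0 iota_inj)) (expf_neq0 2 (x_neq0 iota_inj)))).
- by move=> n; apply: qpoch_coef0; rewrite coefXn mulnS.
- exact: ord_ge_x2.
- exact: ord_ge_x.
- exact: regular_prefactor.
- move=> n; rewrite !rmorphM !rmorphXn !iota_qpoch !rmorphXn /=.
  rewrite [RHS]mulrA delta_x1 //.
  have h1 : poch (x ^+ 2) (x ^+ 2) n != 0 by apply: poch_neq0 (one_sub_sqr_exp_neq0 (one_sub_x_neq0 iota_inj)) _.
  have h2 := poch_neq0 (one_sub_sqr_exp_neq0 (one_sub_x_neq0 iota_inj)) (2 * n + 1).
  have eP : poch (x ^+ 2) (x ^+ 2) (2 * n + 1) =
      poch (x ^+ 2) (x ^+ 2) n * poch (x ^+ (2 * n.+1)) (x ^+ 2) n.+1.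
    have -> : (2 * n + 1 = n + n.+1)%N by lia.
    by rewrite poch_cat -exprS -exprM.
  move: h2; rewrite eP mulf_eq0 !addn1 => /norP[_ h2]; field.
  by rewrite h1 h2.
- by move=> r; apply: regular_alpha_f6; exact: regular_x.
move=> r; rewrite big_cons big_seq1 mulrCA gamma_x1 // /inner_f6.
have h3 : 1 - x ^+ (2 * r + 2) != 0 by rewrite addn2 one_sub_x_neq0.
transitivity (x ^+ r.+1 * (1 + x ^+ (2 * r + 2)) * ((-1) ^+ r * \sum_(j <- parity_range r) (x ^+ 2) ^+ exp_f6 r j)).
  by rewrite exprsq; field.
rewrite mulrCA mulr_sumr mulr_sumr -big_split /=; apply: eq_bigr => j _.
by rewrite !iota_monomial mul0n addn0 mul1n -exprM !exprD; ring.
Qed.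

(** The base is q^2, so the exponents of the pair double; the factor
    1 + x^(2r+2) gives the two residue classes of u modulo 3. *)
Lemma f8_count k :
  exists2 m, counted (sol 3 (2 * (3 * k%:Z - 1))) m & f8 k = (-1) ^+ k.+1 * m%:Z.
Proof.
rewrite coef_f8.
apply: (hecke_sum_coef (UV := fun b r j => (3 * r%:Z + 2 + 2 * b%:Z, j))) => //.
- exact: parity_range_uniq.
- by move=> b r j b' r' j' _ _ _ _ [] e ->; move: e; case: b; case: b'; split => //; lia.
- move=> b r j; rewrite mem_parity_range => /andP[hj hp] Ek; split => /=.
    apply/sol_iff; move: Ek (sqr_le_sym hj) (triangular r); rewrite /exp_f6; set C := 'C(_, _).
    have [i ei] : exists i, j = 2 * i - r%:Z.
      by exists (absz (j + r%:Z)%R %/ 2)%N%:Z; lia.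
    by rewrite ei in hj *; case: b; rewrite ?mul1n ?mul0n; split; lia.
  by apply: sign_parity; move: Ek; case: b; rewrite ?mul1n ?mul0n; lia.
move=> u v /sol_iff[e1 e2].
have [a [t [eu t3]]] := @int_mod 3 u isT.
have pv : exists i, v = 2 * i - u.
  have [b [t' [eb t2]]] := @int_mod 2 (v + u) isT.
  case: t' eb t2 => [|[|t']] // eb _; first by exists b; lia.
  exfalso; have ev : v = 2 * b + 1 - u by lia.
  by rewrite ev in e1; lia.
have [i ei] := pv.
case: t eu t3 => [|[|[|t]]] // eu _; [by exfalso; rewrite eu in e1; lia| |].
- have [n en] : exists n : nat, a = n%:Z + 1 by exists (absz (a - 1)); lia.
  rewrite en in eu.
  have hc : - n%:Z <= v <= n%:Z by lia.
  have hc' := sqr_le_sym hc.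
  exists true, n, v; rewrite mem_parity_range; split => //.
  + by rewrite eu in e1; nia.
  + by lia.
  + rewrite mul1n /exp_f6; rewrite eu in e1 ei; move: hc hc' e1 (triangular n); rewrite ei.
    by set C := 'C(_, _); lia.
  + by congr (_, _); lia.
- have [n en] : exists n : nat, a = n%:Z by exists (absz a); lia.
  rewrite en in eu.
  have hc : - n%:Z <= v <= n%:Z by lia.
  have hc' := sqr_le_sym hc.
  exists false, n, v; rewrite mem_parity_range; split => //.
  + by rewrite eu in e1; nia.
  + by lia.
  + rewrite mul0n /exp_f6; rewrite eu in e1 ei; move: hc hc' e1 (triangular n); rewrite ei.
    by set C := 'C(_, _); lia.
  + by congr (_, _); lia.
Qed.
End CoefficientsF6F8.

(** * The coefficients of f1 and f2 *)

Lemma fps_div_comp_even (N D : {poly int}) k : D`_0 = 1 ->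
  fps_div (N \Po 'X^2) (D \Po 'X^2) (2 * k)%N = fps_div N D k.
Proof.
move=> D0; rewrite (fps_div_trunc (M := (2 * k).+1) N D0); last by lia.
rewrite coef_sum; apply: eq_bigr => j _.
have -> : (N \Po 'X^2) * (1 - (D \Po 'X^2)) ^+ j = (N * (1 - D) ^+ j) \Po 'X^2.
  by rewrite rmorphM rmorphXn rmorphB rmorph1.
by rewrite coef_comp_poly_Xn // dvdn_mulr // mulKn.
Qed.

Lemma fps_div_comp_odd (N D : {poly int}) k :
  fps_div (N \Po 'X^2) (D \Po 'X^2) (2 * k).+1%N = 0.
Proof.
apply: big1 => j _.
have -> : (N \Po 'X^2) * (1 - (D \Po 'X^2)) ^+ j = (N * (1 - D) ^+ j) \Po 'X^2.
  by rewrite rmorphM rmorphXn rmorphB rmorph1.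
have e : (2 %| (2 * k).+1)%N = false by rewrite dvdn2 /= mul2n odd_double.
by rewrite coef_comp_poly_Xn // e.
Qed.

Lemma fps_divD (A B D : {poly int}) k :
  fps_div (A + B) D k = fps_div A D k + fps_div B D k.
Proof. by rewrite -big_split /=; apply: eq_bigr => j _; rewrite mulrDl coefD. Qed.

Lemma fps_divX (A D : {poly int}) k : D`_0 = 1 ->
  fps_div ('X * A) D k.+1 = fps_div A D k.
Proof.
move=> D0; rewrite (fps_div_trunc (M := k.+2) A D0) // coef_sum.
by apply: eq_bigr => j _; rewrite -mulrA coefXM.
Qed.

Lemma fps_divX0 (A D : {poly int}) : fps_div ('X * A) D 0 = 0.
Proof. by rewrite /fps_div big_ord1 expr0 mulr1 coefXM. Qed.

Lemma fps_divX_even (A D : {poly int}) k : D`_0 = 1 ->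
  fps_div ('X * (A \Po 'X^2)) (D \Po 'X^2) (2 * k)%N = 0.
Proof.
move=> D0; case: k => [|k]; first by rewrite muln0 fps_divX0.
rewrite mulnS add2n fps_divX ?fps_div_comp_odd //.
by rewrite coef_comp_poly_Xn // dvdn0 div0n.
Qed.

Definition exp_f1 (r : nat) (j : int) : nat := absz (r%:Z * r%:Z - j * j)%R.

Section CoefficientsF1F2.
Variables (L : fieldType) (iota : {rmorphism {poly int} -> L}).
Hypothesis iota_inj : injective iota.
Local Notation x := (iota 'X).

Definition inner_f1 r : L := (-1) ^+ r * \sum_(j <- sym_range r) 1 * x ^+ exp_f1 r j.

Lemma bailey_pair_f1_x n : \sum_(r < n.+1) (1 + x ^+ (2 * r + 1)) * inner_f1 r * weight (x ^+ 2) 1 n r =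
   (-1) ^+ n / (poch ((x ^+ 2) ^+ 2) ((x ^+ 2) ^+ 2) n * (1 - x ^+ (2 * n + 1))).
Proof.
apply: (bailey_pair_f1 (one_sub_x_neq0 iota_inj) (x_neq0 iota_inj)); first by rewrite /inner_f1 big_seq1 !mul1r.
move=> r; rewrite /inner_f1 (@sym_range_rec _ _ (fun=> 1) exp_f1 (2 * r + 1) 0 0).
- by rewrite expr0 [(-1) ^+ r.+1]exprS; ring.
- by move=> j hj; have := sqr_le_sym hj; rewrite /exp_f1; lia.
- by rewrite /exp_f1; lia.
- by rewrite /exp_f1; lia.
Qed.

Lemma regular_alpha_f1 r : ord_ge iota 0 ((1 + x ^+ (2 * r + 1)) * inner_f1 r).
Proof.
apply: (ord_geMl iota_inj); first by apply: (ord_geD iota_inj); [exact: regular1 | exact: regular_x].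
apply: (ord_geMl iota_inj); first exact: regular_sign.
by apply: (regular_sum iota_inj) => j; exact: regular1.
Qed.

Definition num_f1 n : {poly int} := 'X^((n ^ 2 + n) %/ 2) * qpoch 'X 'X (2 * n).
Definition num_f2 n : {poly int} := 'X^((n.+1 ^ 2 + n.+1) %/ 2) * qpoch 'X 'X (2 * n).
Definition den_f12 n : {poly int} := qpoch (- 'X) 'X n * qpoch 'X 'X (2 * n + 1).

Lemma qpoch_comp a Q n : qpoch a Q n \Po 'X^2 = qpoch (a \Po 'X^2) (Q \Po 'X^2) n.
Proof.
rewrite rmorph_prod; apply: eq_bigr => i _.
by rewrite rmorphB rmorph1 rmorphM rmorphXn.
Qed.

(** The coefficients of x W(x). In f1(x^2) and f2(x^2)/x the n-th terms are
    1 and x^(2n+1) times x^(n^2+n) / ((-x^2;x^2)_n (1 - x^(4n+2))), so their sum has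
    the denominator 1 - x^(2n+1). *)
Lemma coef_W K : \sum_(n < K.+2)
    fps_div ('X * (num_f1 n \Po 'X^2) + (num_f2 n \Po 'X^2)) (den_f12 n \Po 'X^2) K =
  (hecke_sum [:: false; true] K.+1 sym_range (fun _ _ _ => 1)
    (fun b r j => (1 + 2 * 'C(r.+1, 2) + exp_f1 r j + b * (2 * r + 1))%N))`_K.
Proof.
apply: (@series_coef _ _ iota_inj (fun n => 'X * (num_f1 n \Po 'X^2) + (num_f2 n \Po 'X^2))
  (fun n => den_f12 n \Po 'X^2) (x ^+ 2) 0 x 0 _ _ _ _ _ _ _ _ _ _ _ _ regular_alpha_f1 bailey_pair_f1_x).
- move=> n; rewrite coef_comp_poly_Xn // dvdn0 div0n.
  by have [[]] := denominators_coef0 n.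
- exact: ord_ge_x2.
- exact: ord_ge_zero.
- exact: (regular_poly iota).
- move=> n.
  rewrite /num_f1 /num_f2 /den_f12 !(rmorphM (comp_poly 'X^2)) !(rmorphXn (comp_poly 'X^2)) /= !qpoch_comp.
  rewrite (rmorphN (comp_poly 'X^2)) /= comp_polyX.
  rewrite !rmorphD !rmorphM !rmorphXn /= !iota_qpoch !rmorphN !rmorphXn /=.
  rewrite /delta zpow_zero -(poch_sqr (x ^+ 2)) !half_sq_add (addn1 (2 * n)) [poch _ _ (2 * n).+1]pochS -(addn1 (2 * n)).
  have -> : x ^+ 2 * (x ^+ 2) ^+ (2 * n) = (x ^+ (2 * n + 1)) ^+ 2.
    by rewrite -!exprM -exprD; congr (_ ^+ _); lia.
  have h1 := poch_neq0 (one_sub_sqr_exp_neq0 (one_sub_x_neq0 iota_inj)) n.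
  have h2 := poch_opp_neq0 (one_sub_sqr_exp_neq0 (one_sub_x_neq0 iota_inj)) n.
  have h3 := poch_neq0 (one_sub_sqr_exp_neq0 (one_sub_x_neq0 iota_inj)) (2 * n).
  have h4 : 1 - x ^+ (2 * n + 1) != 0 by rewrite addn1 one_sub_x_neq0.
  have h5 : 1 + x ^+ (2 * n + 1) != 0 by rewrite addn1 one_add_exp_neq0 // => k; exact: one_sub_x_neq0.
  have h6 : 1 - (x ^+ (2 * n + 1)) ^+ 2 != 0.
    have -> : 1 - (x ^+ (2 * n + 1)) ^+ 2 = (1 - x ^+ (2 * n + 1)) * (1 + x ^+ (2 * n + 1)) by ring.
    by rewrite mulf_neq0.
  have -> : (x ^+ 2) ^+ 'C(n.+2, 2) = (x ^+ 2) ^+ 'C(n.+1, 2) * (x * x ^+ (2 * n + 1)).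
    rewrite -!exprM -exprS -exprD; congr (_ ^+ _).
    by have := triangular n; have := triangular n.+1; lia.
  transitivity (x * ((-1) ^+ n * (-1) ^+ n) * (x ^+ 2) ^+ 'C(n.+1, 2) / (poch (- x ^+ 2) (x ^+ 2) n * (1 - x ^+ (2 * n + 1)))).
    rewrite -expr2 sqrr_sign mulr1; field; by rewrite h2 h3 h4 h6.
  by field; rewrite h1 h2 h4.
move=> r; rewrite big_cons big_seq1 /gamma poch_zero zpow_zero addn0 mulr1 -exprM /inner_f1.
have -> : poch (x ^+ 2) (x ^+ 2) r * ((-1) ^+ r * x ^+ (2 * 'C(r.+1, 2))) / poch (x ^+ 2) (x ^+ 2) r = (-1) ^+ r * x ^+ (2 * 'C(r.+1, 2)).
  by have h := poch_neq0 (one_sub_sqr_exp_neq0 (one_sub_x_neq0 iota_inj)) r; field.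
transitivity (((-1) ^+ r * (-1) ^+ r) * (x * x ^+ (2 * 'C(r.+1, 2)) * (1 + x ^+ (2 * r + 1))) * \sum_(j <- sym_range r) 1 * x ^+ exp_f1 r j); first by ring.
rewrite -expr2 sqrr_sign mul1r mulr_sumr -big_split /=; apply: eq_bigr => j _.
by rewrite !scale1r !rmorphXn /= mul0n addn0 mul1n !exprD expr1; ring.
Qed.

Lemma W_count K : exists2 m, counted (sol 2 (8 * K%:Z - 7)) m &
  \sum_(n < K.+2)
    fps_div ('X * (num_f1 n \Po 'X^2) + (num_f2 n \Po 'X^2)) (den_f12 n \Po 'X^2) K = m%:Z.
Proof.
suff [m hm e] : exists2 m, counted (sol 2 (8 * K%:Z - 7)) m &
  \sum_(n < K.+2)
    fps_div ('X * (num_f1 n \Po 'X^2) + (num_f2 n \Po 'X^2)) (den_f12 n \Po 'X^2) K = 1 * m%:Z.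
  by exists m => //; rewrite e mul1r.
rewrite coef_W.
apply: (hecke_sum_coef (UV := fun b r j => (4 * r%:Z + 1 + 2 * b%:Z, 2 * j))) => //.
- exact: sym_range_uniq.
- move=> b r j b' r' j' _ _ _ _ [] e e'.
  by move: e; case: b; case: b'; split => //; lia.
- move=> b r j; rewrite mem_sym_range => hj Ek; split => //.
  apply/sol_iff; move: Ek (sqr_le_sym hj) (triangular r); rewrite /exp_f1; set C := 'C(_, _).
  by case: b; rewrite ?mul1n ?mul0n; split; lia.
move=> u v /sol_iff[h1 h2].
have [a [t [eu t3]]] := @int_mod 4 u isT.
have [b [t' [ev t2]]] := @int_mod 2 v isT.
have hv : t' = 0%N.
  case: t' ev t2 => [|[|t']] // ev _; exfalso; rewrite ev in h1.
  by case: t eu t3 => [|[|[|[|t]]]] // eu _; rewrite eu in h1; lia.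
rewrite hv addr0 in ev; rewrite ev in h1 h2.
have a0 : 0 <= a by lia.
have [n en] : exists n : nat, a = n%:Z by exists (absz a); lia.
rewrite en in eu.
case: t eu t3 => [|[|[|[|t]]]] // eu _; rewrite eu in h1 h2; [lia| |lia|].
- have hc : - n%:Z <= b <= n%:Z by lia.
  have hc' := sqr_le_sym hc.
  exists false, n, b; rewrite mem_sym_range; split => //.
  + by nia.
  + by have := triangular n; rewrite mul0n /exp_f1; set C := 'C(_, _); lia.
  + by congr (_, _); lia.
- have hc : - n%:Z <= b <= n%:Z by lia.
  have hc' := sqr_le_sym hc.
  exists true, n, b; rewrite mem_sym_range; split => //.
  + by nia.
  + by have := triangular n; rewrite mul1n /exp_f1; set C := 'C(_, _); lia.
  + by congr (_, _); lia.
Qed.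

Lemma den_f12_coef0 n : (den_f12 n)`_0 = 1.
Proof. by have [[]] := denominators_coef0 n. Qed.

Lemma den_f12_comp_coef0 n : (den_f12 n \Po 'X^2)`_0 = 1.
Proof. by rewrite coef_comp_poly_Xn // dvdn0 div0n den_f12_coef0. Qed.

Lemma t2E n : t2 n.+1 = fps_div (num_f2 n) (den_f12 n).
Proof.
rewrite /t2 /num_f2 /den_f12.
have -> : (2 * n.+1 - 2 = 2 * n)%N by lia.
have -> : (2 * n.+1 - 1 = 2 * n + 1)%N by lia.
by have -> : (n.+1 - 1 = n)%N by lia.
Qed.

Lemma f1_count k : exists2 m, counted (sol 2 (16 * k%:Z + 1)) m & f1 k = m%:Z.
Proof.
have [m hm e] := W_count (2 * k).+1; exists m.
  by congr (counted (sol 2 _) m): hm; lia.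
rewrite -e /f1 (fps_sum_trunc (M := (2 * k).+3)); first last.
- by lia.
- by move=> n _ /terms_low[[]].
rewrite big_mkord; apply: eq_bigr => n _.
by rewrite fps_divD fps_div_comp_odd addr0 fps_divX ?den_f12_comp_coef0 // fps_div_comp_even ?den_f12_coef0.
Qed.

Lemma f2_count k : exists2 m, counted (sol 2 (16 * k%:Z - 7)) m & f2 k = m%:Z.
Proof.
have [m hm e] := W_count (2 * k); exists m.
  by congr (counted (sol 2 _) m): hm; lia.
rewrite -e /f2 (fps_sum_trunc (M := (2 * k).+3)); first last.
- by lia.
- by move=> n _ /terms_low[[]].
rewrite big_add1 big_mkord; apply: eq_bigr => n _.
rewrite t2E fps_divD fps_div_comp_even ?den_f12_coef0 //.
by rewrite fps_divX_even ?den_f12_coef0 // add0r.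
Qed.
End CoefficientsF1F2.

(** * Arithmetic of the quadratic forms *)

Lemma counted_uniq P m n : counted P m -> counted P n -> m = n.
Proof.
move=> [s [us hs <-]] [t [ut ht <-]]; apply/eqP; rewrite -uniq_size_uniq //.
by move=> x; rewrite hs ht.
Qed.

Lemma counted_ext P P' m : P =1 P' -> counted P m -> counted P' m.
Proof.
move=> e [s [us hs sz]]; exists s; split=> // x.
by rewrite hs -!topredE /= e.
Qed.

Lemma counted_bij (P P' : pred (int * int)) (phi : int * int -> int * int) m :
  (forall x, P x -> P' (phi x)) ->
  (forall x y, P x -> P y -> phi x = phi y -> x = y) ->
  (forall y, P' y -> exists2 x, P x & phi x = y) ->
  counted P m -> counted P' m.
Proof.
move=> hP inj surj [s [us hs sz]]; exists (map phi s); split.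
- by rewrite map_inj_in_uniq // => x y; rewrite !hs; apply: inj.
- move=> y; apply/mapP/idP => [[x]|/surj [x Px <-]]; first by rewrite hs => /hP ? ->.
  by exists x => //; rewrite hs.
- by rewrite size_map.
Qed.

Lemma counted_split (P R : pred (int * int)) m n :
  counted (fun x => P x && R x) m -> counted (fun x => P x && ~~ R x) n ->
  counted P (m + n).
Proof.
move=> [s [us hs <-]] [t [ut ht <-]]; exists (s ++ t); split.
- rewrite cat_uniq us ut andbT /=; apply/hasPn => x.
  by rewrite ht hs -!topredE /= => /andP[-> /negbTE ->].
- move=> x; rewrite mem_cat hs ht -!topredE /=; by case: (P x) (R x) => [] [].
- by rewrite size_cat.
Qed.

Lemma Euclid_dvdzM (p : nat) (a b : int) : prime p ->
  (p%:Z %| a * b)%Z -> (p%:Z %| a)%Z || (p%:Z %| b)%Z.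
Proof. by move=> pp; rewrite !dvdzE abszM Euclid_dvdM. Qed.

(** Divisibility of u + v sqrt 2 by pi = 5 + 2 sqrt 2, read off from the product with the
    conjugate of pi. *)
Definition pi17_dvd (x : int * int) : bool := (17 %| 5 * x.2 - 2 * x.1)%Z.

(** Multiplication by pi = 5 + 2 sqrt 2, of norm 17. As pi lies in the cone, the
    product lies in it or in its image under the unit, and in the second case
    it is divided by the unit. *)
Definition mul_pi17 (x : int * int) : int * int :=
  let w := (5 * x.1 + 4 * x.2, 5 * x.2 + 2 * x.1) in
  if 2 * w.2 <= w.1 then w else (3 * w.1 - 4 * w.2, 3 * w.2 - 2 * w.1).

(** Multiplication by the conjugate 5 - 2 sqrt 2, followed by the unit if the
    product has left the cone. *)
Definition mul_conj_pi17 (x : int * int) : int * int :=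
  let w := (5 * x.1 - 4 * x.2, 5 * x.2 - 2 * x.1) in
  if 0 < w.1 + 2 * w.2 then w else (3 * w.1 + 4 * w.2, 3 * w.2 + 2 * w.1).

Lemma mul_pi17_count N m : counted (sol 2 N) m ->
  counted (fun x => sol 2 (17 * N) x && pi17_dvd x) m.
Proof.
apply: (counted_bij (phi := mul_pi17)).
- move=> [u v] /sol_iff[e1 e2]; apply/andP; rewrite /mul_pi17 /pi17_dvd /=.
  by case: leP => h /=; split; rewrite ?sol_iff; try lia; apply/sol_iff; split; lia.
- move=> [u v] [u' v'] /sol_iff[_ h1] /sol_iff[_ h2]; rewrite /mul_pi17 /=.
  by case: leP => h; case: leP => h' [] e e'; congr (_, _); lia.
move=> [u v] /andP[/sol_iff[e1 e2]]; rewrite /pi17_dvd /= => /dvdzP[c hc].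
have [y hy] : exists y, v - 5 * c = 2 * y by exists ((v - 5 * c) %/ 2)%Z; lia.
have eu : u = 5 * y + 4 * c by lia.
have ev : v = 5 * c + 2 * y by lia.
rewrite eu ev in e1 e2 *.
have [h|h] := ltP 0 (y + 2 * c).
- exists (y, c); first by apply/sol_iff; split; lia.
  by rewrite /mul_pi17 /=; case: leP => h' //; lia.
- exists (3 * y + 4 * c, 3 * c + 2 * y); first by apply/sol_iff; split; lia.
  by rewrite /mul_pi17 /=; case: leP => h' //; [lia | congr (_, _); lia].
Qed.

(** If the norm of an element is divisible by 17 and pi does not divide it, then the
    conjugate of pi does: 17 divides (5v - 2u)(5v + 2u). *)
Lemma mul_conj_pi17_count N m : counted (fun x => sol 2 N x && ~~ pi17_dvd x) m ->
  counted (fun x => sol 2 (17 * N) x && ~~ pi17_dvd x) m.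
Proof.
apply: (counted_bij (phi := mul_conj_pi17)).
- move=> [u v] /andP[/sol_iff[e1 e2]]; rewrite /mul_conj_pi17 /pi17_dvd /= => h0.
  by apply/andP; case: ltP => h /=; split; try (apply/sol_iff; split); lia.
- move=> [u v] [u' v'] /andP[/sol_iff[_ h1] _] /andP[/sol_iff[_ h2] _]; rewrite /mul_conj_pi17 /=.
  by case: ltP => h; case: ltP => h' [] e e'; congr (_, _); lia.
move=> [u v] /andP[/sol_iff[e1 e2]]; rewrite /pi17_dvd /= => h0.
have : (17 %| (5 * v - 2 * u) * (5 * v + 2 * u))%Z.
  by apply/dvdzP; exists (v * v - 4 * N); lia.
move/(@Euclid_dvdzM 17 _ _ isT); rewrite (negbTE h0) /= => /dvdzP[c hc].
have [y hy] : exists y, 5 * c - v = 2 * y by exists ((5 * c - v) %/ 2)%Z; lia.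
have eu : u = 5 * y - 4 * c by lia.
have ev : v = 5 * c - 2 * y by lia.
rewrite eu ev in h0 e1 e2 *.
have [h|h] := leP (2 * c) y.
- exists (y, c).
    by rewrite /pi17_dvd /=; apply/andP; split; [apply/sol_iff; split; lia | lia].
  by rewrite /mul_conj_pi17 /=; case: ltP => h' //; lia.
- exists (3 * y - 4 * c, 3 * c - 2 * y).
    by rewrite /pi17_dvd /=; apply/andP; split; [apply/sol_iff; split; lia | lia].
  by rewrite /mul_conj_pi17 /=; case: ltP => h' //; [lia | congr (_, _); lia].
Qed.

(** Divisibility of u + v sqrt 3 by 4 + sqrt 3, of norm 13. *)
Definition pi13_dvd (x : int * int) : bool := (13 %| 4 * x.2 - x.1)%Z.

Definition mul_pi13 (x : int * int) : int * int :=
  let w := (4 * x.1 + 3 * x.2, 4 * x.2 + x.1) in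
  if 3 * w.2 <= w.1 then w else (2 * w.1 - 3 * w.2, 2 * w.2 - w.1).

Definition mul_conj_pi13 (x : int * int) : int * int :=
  let w := (4 * x.1 - 3 * x.2, 4 * x.2 - x.1) in
  if 0 < w.1 + 3 * w.2 then w else (2 * w.1 + 3 * w.2, 2 * w.2 + w.1).

Lemma mul_pi13_count N m : counted (sol 3 N) m ->
  counted (fun x => sol 3 (13 * N) x && pi13_dvd x) m.
Proof.
apply: (counted_bij (phi := mul_pi13)).
- move=> [u v] /sol_iff[e1 e2]; apply/andP; rewrite /mul_pi13 /pi13_dvd /=.
  by case: leP => h /=; split; try (apply/sol_iff; split); lia.
- move=> [u v] [u' v'] /sol_iff[_ h1] /sol_iff[_ h2]; rewrite /mul_pi13 /=.
  by case: leP => h; case: leP => h' [] e e'; congr (_, _); lia.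
move=> [u v] /andP[/sol_iff[e1 e2]]; rewrite /pi13_dvd /= => /dvdzP[c hc].
have [y hy] : exists y, v - 4 * c = y by exists (v - 4 * c).
have eu : u = 4 * y + 3 * c by lia.
have ev : v = 4 * c + y by lia.
rewrite eu ev in e1 e2 *.
have [h|h] := ltP 0 (y + 3 * c).
- exists (y, c); first by apply/sol_iff; split; lia.
  by rewrite /mul_pi13 /=; case: leP => h' //; lia.
- exists (2 * y + 3 * c, 2 * c + y); first by apply/sol_iff; split; lia.
  by rewrite /mul_pi13 /=; case: leP => h' //; [lia | congr (_, _); lia].
Qed.

Lemma mul_conj_pi13_count N m : counted (fun x => sol 3 N x && ~~ pi13_dvd x) m ->
  counted (fun x => sol 3 (13 * N) x && ~~ pi13_dvd x) m.
Proof.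
apply: (counted_bij (phi := mul_conj_pi13)).
- move=> [u v] /andP[/sol_iff[e1 e2]]; rewrite /mul_conj_pi13 /pi13_dvd /= => h0.
  by apply/andP; case: ltP => h /=; split; try (apply/sol_iff; split); lia.
- move=> [u v] [u' v'] /andP[/sol_iff[_ h1] _] /andP[/sol_iff[_ h2] _]; rewrite /mul_conj_pi13 /=.
  by case: ltP => h; case: ltP => h' [] e e'; congr (_, _); lia.
move=> [u v] /andP[/sol_iff[e1 e2]]; rewrite /pi13_dvd /= => h0.
have : (13 %| (4 * v - u) * (4 * v + u))%Z.
  by apply/dvdzP; exists (v * v - N); lia.
move/(@Euclid_dvdzM 13 _ _ isT); rewrite (negbTE h0) /= => /dvdzP[c hc].
have [y hy] : exists y, 4 * c - v = y by exists (4 * c - v).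
have eu : u = 4 * y - 3 * c by lia.
have ev : v = 4 * c - y by lia.
rewrite eu ev in h0 e1 e2 *.
have [h|h] := leP (3 * c) y.
- exists (y, c).
    by rewrite /pi13_dvd /=; apply/andP; split; [apply/sol_iff; split; lia | lia].
  by rewrite /mul_conj_pi13 /=; case: ltP => h' //; lia.
- exists (2 * y - 3 * c, 2 * c - y).
    by rewrite /pi13_dvd /=; apply/andP; split; [apply/sol_iff; split; lia | lia].
  by rewrite /mul_conj_pi13 /=; case: ltP => h' //; [lia | congr (_, _); lia].
Qed.

(** The induction carries along the number of solutions not divisible by pi, which
    is constant in k. *)
Lemma prime_power_count (d N : int) (p c : nat) (R : pred (int * int)) k :
  (forall M m, counted (sol d M) m -> counted (fun x => sol d (p%:Z * M) x && R x) m) ->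
  (forall M m, counted (fun x => sol d M x && ~~ R x) m ->
     counted (fun x => sol d (p%:Z * M) x && ~~ R x) m) ->
  (forall x, sol d N x -> ~~ R x) -> counted (sol d N) c ->
  counted (sol d (p%:Z ^+ k * N)) (k.+1 * c).
Proof.
move=> up down NR cN.
suff [] : counted (sol d (p%:Z ^+ k * N)) (k.+1 * c) /\
  counted (fun x => sol d (p%:Z ^+ k * N) x && ~~ R x) c by [].
elim: k => [|k [IH1 IH2]].
  rewrite mul1r mul1n; split=> //; apply: counted_ext cN => x.
  by case e: (sol d N x) => //=; rewrite NR.
rewrite exprS -mulrA; split; last exact: down.
by rewrite mulSnr; apply: counted_split; [apply: up | apply: down].
Qed.

(** When s^2 can divide a norm only if s divides the element, scaling by s is a
    bijection; the cone is homogeneous. *)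
Lemma scale_count (d N : int) (s m : nat) : (0 < s)%N ->
  (forall u v : int, (s%:Z * s%:Z %| u * u - d * (v * v))%Z ->
     (s%:Z %| u)%Z && (s%:Z %| v)%Z) ->
  counted (sol d N) m -> counted (sol d (s%:Z * s%:Z * N)) m.
Proof.
move=> s0 hs; have s1 : 0 < s%:Z by [].
apply: (counted_bij (phi := fun x => (s%:Z * x.1, s%:Z * x.2))).
- move=> [u v] /sol_iff[e1 e2] /=; apply/sol_iff; split; first by rewrite -e1; ring.
  by rewrite mulrCA -mulrN ltr_pM2l // ler_pM2l.
- move=> [u v] [u' v'] _ _ /= [].
  by move=> /(mulfI (lt0r_neq0 s1)) -> /(mulfI (lt0r_neq0 s1)) ->.
move=> [u v] /sol_iff[e1 e2].
have /andP[/dvdzP[a ea] /dvdzP[b eb]] : (s%:Z %| u)%Z && (s%:Z %| v)%Z.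
  by apply: hs; rewrite e1 dvdz_mulr.
exists (a, b); last by rewrite /= ea eb; congr (_, _); rewrite mulrC.
apply/sol_iff; rewrite ea eb in e1 e2; split.
  have ss : s%:Z * s%:Z != 0 by rewrite mulf_neq0 // lt0r_neq0.
  by apply: (mulfI ss); rewrite -e1; ring.
by move: e2; rewrite mulrA -mulNr ltr_pM2r // ler_pM2r.
Qed.

Lemma three_inert (u v : int) : (9 %| u * u - 2 * (v * v))%Z -> (3 %| u)%Z && (3 %| v)%Z.
Proof.
have [a [t [eu t3]]] := @int_mod 3 u isT; have [b [t' [ev t3']]] := @int_mod 3 v isT.
move=> h; rewrite eu ev in h *.
case: t t3 {eu} h => [|[|[|t]]] // _; case: t' t3' {ev} => [|[|[|t']]] // _; lia.
Qed.

Lemma five_inert (u v : int) : (25 %| u * u - 3 * (v * v))%Z -> (5 %| u)%Z && (5 %| v)%Z.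
Proof.
have [a [t [eu t3]]] := @int_mod 5 u isT; have [b [t' [ev t3']]] := @int_mod 5 v isT.
move=> h; rewrite eu ev in h *.
case: t t3 {eu} h => [|[|[|[|[|t]]]]] // _; case: t' t3' {ev} => [|[|[|[|[|t']]]]] // _; lia.
Qed.

Lemma pi17_dvd_norm M x : sol 2 M x -> pi17_dvd x -> (17 %| M)%Z.
Proof.
case: x => u v /sol_iff[<- _]; rewrite /pi17_dvd /= => /dvdzP[c hc].
have [y hy] : exists y, v - 5 * c = 2 * y by exists ((v - 5 * c) %/ 2)%Z; lia.
have eu : u = 5 * y + 4 * c by lia.
have ev : v = 5 * c + 2 * y by lia.
by apply/dvdzP; exists (y * y - 2 * (c * c)); rewrite eu ev; ring.
Qed.

Lemma pi13_dvd_norm M x : sol 3 M x -> pi13_dvd x -> (13 %| M)%Z.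
Proof.
case: x => u v /sol_iff[<- _]; rewrite /pi13_dvd /= => /dvdzP[c hc].
have eu : u = 4 * v - 13 * c by lia.
by apply/dvdzP; exists (v * v - 8 * (v * c) + 13 * (c * c)); rewrite eu; ring.
Qed.

(** The factor 81 = 3^4 makes infinitely many norms with the same count, and both
    17 and 81 are 1 modulo 16. *)
Lemma count_family2 (N : int) (c k B : nat) : counted (sol 2 N) c -> ~~ (17 %| N)%Z ->
  exists2 t, (B <= t)%N & counted (sol 2 (N * (16 * t%:Z + 1))) (k.+1 * c).
Proof.
move=> cN hN.
have [t Bt et] : exists2 t, (B <= t)%N & 17 ^+ k * 81 ^+ B = 16 * t%:Z + 1.
  elim: B => [|B [t Bt et]].
    elim: k => [|k [t _ et]]; first by exists 0%N.
    by exists (17 * t + 1)%N => //; rewrite exprS; lia.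
  by exists (81 * t + 5)%N; [lia | rewrite exprS; lia].
exists t => //; rewrite -et mulrCA.
have [cM hM] : counted (sol 2 (N * 81 ^+ B)) c /\ ~~ (17 %| N * 81 ^+ B)%Z.
  elim: (B) => [|b [IH1 IH2]]; first by rewrite mulr1.
  have e : N * 81 ^+ b.+1 = 3%:Z * 3%:Z * (3%:Z * 3%:Z * (N * 81 ^+ b)).
    by rewrite exprS; ring.
  split; last by rewrite e; lia.
  by rewrite e; do 2 apply: (@scale_count 2 _ 3 c isT three_inert).
apply: (prime_power_count (R := pi17_dvd)) mul_pi17_count mul_conj_pi17_count _ cM => x /pi17_dvd_norm h.
by apply: contra hM.
Qed.

(** Both 13 and 25 are 1 modulo 12. *)
Lemma count_family3 (N : int) (c k B : nat) : counted (sol 3 N) c -> ~~ (13 %| N)%Z ->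
  exists2 t, (B <= t)%N & counted (sol 3 (N * (12 * t%:Z + 1))) (k.+1 * c).
Proof.
move=> cN hN.
have [t Bt et] : exists2 t, (B <= t)%N & 13 ^+ k * 25 ^+ B = 12 * t%:Z + 1.
  elim: B => [|B [t Bt et]].
    elim: k => [|k [t _ et]]; first by exists 0%N.
    by exists (13 * t + 1)%N => //; rewrite exprS; lia.
  by exists (25 * t + 2)%N; [lia | rewrite exprS; lia].
exists t => //; rewrite -et mulrCA.
have [cM hM] : counted (sol 3 (N * 25 ^+ B)) c /\ ~~ (13 %| N * 25 ^+ B)%Z.
  elim: (B) => [|b [IH1 IH2]]; first by rewrite mulr1.
  have e : N * 25 ^+ b.+1 = 5%:Z * 5%:Z * (N * 25 ^+ b) by rewrite exprS; ring.
  split; last by rewrite e; lia.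
  by rewrite e; apply: (@scale_count 3 _ 5 c isT five_inert).
apply: (prime_power_count (R := pi13_dvd)) mul_pi13_count mul_conj_pi13_count _ cM => x /pi13_dvd_norm h.
by apply: contra hM.
Qed.

Lemma no_sol2 (N : int) : (3 %| N)%Z -> ~~ (9 %| N)%Z -> counted (sol 2 N) 0.
Proof.
move=> h3 h9; exists [::]; split=> // -[u v]; apply/esym/negP => /sol_iff[e _].
have [a [t [eu t3]]] := @int_mod 3 u isT; have [b [t' [ev t3']]] := @int_mod 3 v isT.
rewrite -e eu ev in h3 h9.
by case: t t3 {eu} h3 h9 => [|[|[|t]]] // _; case: t' t3' {ev} => [|[|[|t']]] // _; lia.
Qed.

Lemma no_sol3 (N : int) : (5 %| N)%Z -> ~~ (25 %| N)%Z -> counted (sol 3 N) 0.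
Proof.
move=> h3 h9; exists [::]; split=> // -[u v]; apply/esym/negP => /sol_iff[e _].
have [a [t [eu t3]]] := @int_mod 5 u isT; have [b [t' [ev t3']]] := @int_mod 5 v isT.
rewrite -e eu ev in h3 h9.
by case: t t3 {eu} h3 h9 => [|[|[|[|[|t]]]]] // _; case: t' t3' {ev} => [|[|[|[|[|t']]]]] // _; lia.
Qed.

(** Conjugation (u, v) -> (u, -v) exchanges the solutions with v > 0 and v < 0, when
    none lies on the boundary ray d v = u or on v = 0. *)
Lemma counted_even (d N : int) m : counted (sol d N) m ->
  (forall u v, sol d N (u, v) -> d * v != u) ->
  (forall u v, sol d N (u, v) -> v != 0) -> ~~ odd m.
Proof.
move=> [s [us hs <-]] bd z.
pose sg (x : int * int) := (x.1, - x.2).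
have hsg x : x \in s -> sg x \in s.
  case: x => u v; rewrite !hs => h; have := bd _ _ h; move: h => /sol_iff[e1 e2] ne.
  by apply/sol_iff => /=; split; [rewrite -e1; ring | lia].
have sgK : involutive sg by case=> u v; rewrite /sg /= opprK.
have e : size [seq x <- s | 0 < x.2] = size [seq x <- s | ~~ (0 < x.2)].
  rewrite -(size_map sg); apply: perm_size; apply: uniq_perm.
  - by rewrite map_inj_uniq ?filter_uniq //; exact: inv_inj.
  - exact: filter_uniq.
  move=> x; apply/mapP/idP => [[y]|].
    rewrite !mem_filter => /andP[y0 ys] ->; rewrite hsg // andbT.
    by case: y y0 {ys} => u v /=; lia.
  rewrite mem_filter => /andP[x0 xs]; exists (sg x); last by rewrite sgK.
  rewrite mem_filter hsg // andbT /=.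
  by case: x x0 xs => u v /= v0; rewrite hs => /z; lia.
rewrite -(count_predC (fun x : int * int => 0 < x.2)) -!size_filter e.
by rewrite addnn odd_double.
Qed.

(** * The sets of values *)

Lemma sol2_bound N u v : sol 2 N (u, v) -> u * u <= 2 * N.
Proof. by move=> /sol_iff[e h]; nia. Qed.

Lemma sol3_bound N u v : sol 3 N (u, v) -> 2 * (u * u) <= 3 * N.
Proof. by move=> /sol_iff[e h]; nia. Qed.

(** All points of the cone with u <= 5, for d >= 2, and some others: enough for
    the ten small norms below. *)
Definition small_box : seq (int * int) :=
  [seq (u, v) | u <- [:: 1; 2; 3; 4; 5], v <- [:: -2; -1; 0; 1; 2]].

Lemma counted_small d N m : 2 <= d ->
  (forall u v, sol d N (u, v) -> u <= 5) -> count (sol d N) small_box = m ->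
  counted (sol d N) m.
Proof.
move=> d2 small <-; exists [seq x <- small_box | sol d N x]; split.
- exact: filter_uniq.
- move=> [u v]; rewrite mem_filter -[RHS]topredE -[RHS]/(sol d N (u, v)).
  case h : (sol d N (u, v)) => //; have u5 := small _ _ h; rewrite andTb.
  move: h => /sol_iff[_ c]; apply/allpairsP; exists (u, v); split=> //.
    by rewrite !inE /=; lia.
  by rewrite !inE /=; nia.
- exact: size_filter.
Qed.

Lemma count2_1 : counted (sol 2 1) 1.
Proof. by apply: counted_small => // u v /sol2_bound; nia. Qed.
Lemma count2_2 : counted (sol 2 2) 1.
Proof. by apply: counted_small => // u v /sol2_bound; nia. Qed.
Lemma count2_4 : counted (sol 2 4) 1.
Proof. by apply: counted_small => // u v /sol2_bound; nia. Qed.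
Lemma count2_7 : counted (sol 2 7) 2.
Proof. by apply: counted_small => // u v /sol2_bound; nia. Qed.
Lemma count2_9 : counted (sol 2 9) 1.
Proof. by apply: counted_small => // u v /sol2_bound; nia. Qed.
Lemma count3_1 : counted (sol 3 1) 1.
Proof. by apply: counted_small => // u v /sol3_bound; nia. Qed.
Lemma count3_4 : counted (sol 3 4) 1.
Proof. by apply: counted_small => // u v /sol3_bound; nia. Qed.
Lemma count3_6 : counted (sol 3 6) 1.
Proof. by apply: counted_small => // u v /sol3_bound; nia. Qed.
Lemma count3_9 : counted (sol 3 9) 1.
Proof. by apply: counted_small => // u v /sol3_bound; nia. Qed.
Lemma count3_22 : counted (sol 3 22) 2.
Proof. by apply: counted_small => // u v /sol3_bound; nia. Qed.

Lemma inf_valuesP (f : fps) (v : int) :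
  (forall B, exists2 n, (B <= n)%N & f n = v) -> inf_values f v.
Proof.
move=> h /finite_seqP[s es].
have [n hn fn] := h (\max_(i <- s) i).+1.
have : [set` s] n by rewrite -es.
by move=> /= ns; have := @leq_bigmax_seq _ s xpredT id n ns isT; rewrite leqNgt hn.
Qed.

Lemma inf_values_ex (f : fps) (v : int) : inf_values f v -> exists n, f n = v.
Proof. by move=> /infinite_setN0[n]; exists n. Qed.

Section Values.
Variables (d : int) (M sg : nat -> int) (f : fps).
Hypothesis hf : forall k, exists2 m, counted (sol d (M k)) m & f k = sg k * m%:Z.

Lemma value_at k m : counted (sol d (M k)) m -> f k = sg k * m%:Z.
Proof. by move=> h; have [m' h' ->] := hf k; rewrite (counted_uniq h h'). Qed.

Lemma inf_valuesI (s : int) m :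
  (forall B, exists n, [/\ (B <= n)%N, counted (sol d (M n)) m & sg n = s]) ->
  inf_values f (s * m%:Z).
Proof.
move=> h; apply: inf_valuesP => B; have [n [Bn hn <-]] := h B.
by exists n => //; apply: value_at.
Qed.

Lemma inf_values0 : (forall B, exists2 n, (B <= n)%N & counted (sol d (M n)) 0) ->
  inf_values f 0.
Proof.
move=> h; apply: inf_valuesP => B; have [n Bn hn] := h B.
by exists n => //; rewrite (value_at hn) mulr0.
Qed.
End Values.

Definition fraction_embedding : {rmorphism {poly int} -> {fraction {poly int}}} :=
  @FracField.tofrac {poly int}.

Lemma fraction_embedding_inj : injective fraction_embedding.
Proof. by move=> p r /eqP; rewrite tofrac_eq => /eqP. Qed.

Lemma count_nonneg d (M : nat -> int) (f : fps) :
  (forall k, exists2 m, counted (sol d (M k)) m & f k = m%:Z) ->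
  forall k, exists2 m, counted (sol d (M k)) m & f k = 1 * m%:Z.
Proof. by move=> h k; have [m hm e] := h k; exists m => //; rewrite mul1r. Qed.

Lemma inf_values_nonneg d (M : nat -> int) (f : fps) :
  (forall k, exists2 m, counted (sol d (M k)) m & f k = m%:Z) ->
  (forall B, exists2 n, (B <= n)%N & counted (sol d (M n)) 0) ->
  (forall k B, exists2 n, (B <= n)%N & counted (sol d (M n)) k.+1) ->
  inf_values f = intN0.
Proof.
move=> h h0 hS; apply/seteqP; split => v /=.
  by move=> /inf_values_ex[n <-]; have [m _ ->] := h n; exists m.
move=> [[|m] _ <-]; first exact: (inf_values0 (count_nonneg h)).
rewrite -[_%:Z]mul1r; apply: (inf_valuesI (count_nonneg h)) => B.
by have [n Bn hn] := hS m B; exists n.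
Qed.

(** At the exponents 9 B + 2 the norm 16 k + 1 is 6 modulo 9, hence not a norm; the
    other values come from the norms 17^k 81^B. The other series are treated in
    the same way, with a small factor that fits their residue class. *)
Lemma f1_values : inf_values f1 = intN0.
Proof.
apply: (inf_values_nonneg (f1_count fraction_embedding_inj)) => [B|k B].
  by exists (9 * B + 2)%N; [lia | apply: no_sol2; lia].
have [t Bt ht] := @count_family2 1 1 k B count2_1 isT.
exists t => //; move: ht; rewrite muln1; congr (counted (sol 2 _) _); lia.
Qed.

Lemma f2_values : inf_values f2 = intN0.
Proof.
apply: (inf_values_nonneg (f2_count fraction_embedding_inj)) => [B|k B].
  by exists (9 * B + 4)%N; [lia | apply: no_sol2; lia].
have [t Bt ht] := @count_family2 9 1 k B count2_9 isT.
exists (9 * t + 1)%N; first by lia.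
by move: ht; rewrite muln1; congr (counted (sol 2 _) _); lia.
Qed.

Lemma f5_values : inf_values f5 = intN0.
Proof.
apply: (inf_values_nonneg (f5_count fraction_embedding_inj)) => [B|k B].
  by exists (25 * B + 1)%N; [lia | apply: no_sol3; lia].
have [t Bt ht] := @count_family3 6 1 k B count3_6 isT.
exists (3 * t)%N; first by lia.
by move: ht; rewrite muln1; congr (counted (sol 3 _) _); lia.
Qed.

Lemma count_f6_signed k : exists2 m, counted (sol 3 (3 * (4 * k%:Z - 1))) m & f6 k = -1 * m%:Z.
Proof. by have [m hm e] := f6_count fraction_embedding_inj k; exists m => //; rewrite mulN1r. Qed.

Lemma f6_values : inf_values f6 = intoppN0.
Proof.
apply/seteqP; split => v /=.
  move=> /inf_values_ex[n <-]; have [m _ ->] := count_f6_signed n; exists m => //.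
  by rewrite mulN1r.
move=> [[|k] _ <-].
  rewrite oppr0; apply: (inf_values0 count_f6_signed) => B.
  by exists (25 * B + 4)%N; [lia | apply: no_sol3; lia].
rewrite -mulN1r; apply: (inf_valuesI (sg := fun=> -1) count_f6_signed) => B.
have [t Bt ht] := @count_family3 9 1 k B count3_9 isT.
exists (9 * t + 1)%N; split => //; first by lia.
by move: ht; rewrite muln1; congr (counted (sol 3 _) _); lia.
Qed.

Lemma sign_even n : ~~ odd n -> (-1) ^+ n = 1 :> int.
Proof. by rewrite -signr_odd => /negbTE ->. Qed.

Lemma sign_odd n : odd n -> (-1) ^+ n = -1 :> int.
Proof. by rewrite -signr_odd => ->. Qed.

Lemma intZ_cases (v : int) :
  [\/ v = 0, exists k, v = 1 * (k.+1)%:Z | exists k, v = -1 * (k.+1)%:Z].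
Proof.
case: v => [[|k]|k]; first by constructor 1.
  by constructor 2; exists k; rewrite mul1r.
by constructor 3; exists k; rewrite NegzE mulN1r.
Qed.

(** The norm is twice the exponent: the factor 2 gives odd exponents and the sign +,
    the factor 4 gives even exponents and the sign -. *)
Lemma f4_values : inf_values f4 = [set: int].
Proof.
apply/seteqP; split => // v _; have hf := f4_count fraction_embedding_inj.
case: (intZ_cases v) => [->|[k ->]|[k ->]].
- apply: (inf_values0 hf) => B.
  by exists (9 * B + 3)%N; [lia | apply: no_sol2; lia].
- apply: (inf_valuesI hf) => B.
  have [t Bt ht] := @count_family2 2 1 k B count2_2 isT.
  exists (16 * t + 1)%N; split; [lia | | by rewrite sign_even //=; lia].
  by move: ht; rewrite muln1; congr (counted (sol 2 _) _); lia.
- apply: (inf_valuesI hf) => B.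
  have [t Bt ht] := @count_family2 4 1 k B count2_4 isT.
  exists (32 * t + 2)%N; split; [lia | | by rewrite sign_odd //=; lia].
  by move: ht; rewrite muln1; congr (counted (sol 2 _) _); lia.
Qed.

(** Norms 3 k + 1 that are odd belong to even k and the sign +; the factor 4, the
    norm of the element 2, changes the parity of k but not the count. *)
Lemma f7_values : inf_values f7 = [set: int].
Proof.
apply/seteqP; split => // v _; have hf := f7_count fraction_embedding_inj.
case: (intZ_cases v) => [->|[k ->]|[k ->]].
- apply: (inf_values0 hf) => B.
  by exists (25 * B + 3)%N; [lia | apply: no_sol3; lia].
- apply: (inf_valuesI hf) => B.
  have [t Bt ht] := @count_family3 1 1 k B count3_1 isT.
  exists (4 * t)%N; split; [lia | | by rewrite sign_even //=; lia].
  by move: ht; rewrite muln1; congr (counted (sol 3 _) _); lia.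
- apply: (inf_valuesI hf) => B.
  have [t Bt ht] := @count_family3 4 1 k B count3_4 isT.
  exists (16 * t + 1)%N; split; [lia | | by rewrite sign_odd //=; lia].
  by move: ht; rewrite muln1; congr (counted (sol 3 _) _); lia.
Qed.

(** A negative value needs the sign -1, and then the count is even. *)
Lemma inf_values_N0_opp2N d (M sg : nat -> int) (f : fps) :
  (forall k, exists2 m, counted (sol d (M k)) m & f k = sg k * m%:Z) ->
  (forall k m, counted (sol d (M k)) m -> sg k = 1 \/ sg k = -1 /\ ~~ odd m) ->
  (forall B, exists2 n, (B <= n)%N & counted (sol d (M n)) 0) ->
  (forall k B, exists n, [/\ (B <= n)%N, counted (sol d (M n)) k.+1 & sg n = 1]) ->
  (forall k B, exists n, [/\ (B <= n)%N, counted (sol d (M n)) (k.+1 * 2) & sg n = -1]) ->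
  inf_values f = intN0 `|` intopp2N.
Proof.
move=> hf hsg h0 hpos hneg; apply/seteqP; split => v /=.
  move=> /inf_values_ex[n <-]; have [m hm ->] := hf n.
  have [->|[-> em]] := hsg n m hm; first by left; exists m => //; rewrite mul1r.
  case: m em {hm} => [|m] em; first by left; exists 0%N.
  by right; exists (m.+1 %/ 2)%N => /=; lia.
move=> [[[|k] _ <-]|[[|k] //= _ <-]].
- exact: (inf_values0 hf).
- by rewrite -[_%:Z]mul1r; apply: (inf_valuesI hf); exact: hpos.
- by rewrite -mulN1r mulnC; apply: (inf_valuesI hf); exact: hneg.
Qed.

(** For odd k the norm 2 k + 1 is 3 modulo 4, so it is not a square and the
    counts are even; the norm 7 contributes a factor 2 and exponents k of this kind. *)
Lemma f3_values : inf_values f3 = intN0 `|` intopp2N.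
Proof.
apply: (inf_values_N0_opp2N (f3_count fraction_embedding_inj)) => [k m hm|B|k B|k B].
- have [ok|ek] := boolP (odd k); last by left; rewrite sign_even.
  right; split; first by rewrite sign_odd.
  apply: (counted_even hm) => u v /sol_iff[e1 e2]; apply/eqP => e.
    by rewrite -e in e1; lia.
  have [b [t [eb t2]]] := @int_mod 2 u isT.
  by rewrite e eb in e1; case: t t2 {eb} e1 => [|[|t]] // _; lia.
- by exists (9 * B + 1)%N; [lia | apply: no_sol2; lia].
- have [t Bt ht] := @count_family2 1 1 k B count2_1 isT.
  exists (8 * t)%N; split; [lia | | by rewrite sign_even //=; lia].
  by move: ht; rewrite muln1; congr (counted (sol 2 _) _); lia.
- have [t Bt ht] := @count_family2 7 2 k B count2_7 isT.
  exists (56 * t + 3)%N; split; [lia | | by rewrite sign_odd //=; lia].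
  by move: ht; congr (counted (sol 2 _) _); lia.
Qed.

(** For even k the norm 2 (3 k - 1) is twice an odd number, so it is not a square
    and the counts are even; the norm 22 contributes a factor 2 and such k. *)
Lemma f8_values : inf_values f8 = intN0 `|` intopp2N.
Proof.
apply: (inf_values_N0_opp2N (f8_count fraction_embedding_inj)) => [k m hm|B|k B|k B].
- have [ok|ek] := boolP (odd k.+1); last by left; rewrite sign_even.
  right; split; first by rewrite sign_odd.
  apply: (counted_even hm) => u v /sol_iff[e1 e2]; apply/eqP => e.
    by rewrite -e in e1; lia.
  have [b [t [eb t2]]] := @int_mod 2 u isT.
  by rewrite e eb in e1; case: t t2 {eb} e1 => [|[|t]] // _; move: ok => /=; lia.
- by exists (25 * B + 2)%N; [lia | apply: no_sol3; lia].
- have [t Bt ht] := @count_family3 4 1 k B count3_4 isT.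
  exists (8 * t + 1)%N; split; [lia | | by rewrite sign_even //=; lia].
  by move: ht; rewrite muln1; congr (counted (sol 3 _) _); lia.
- have [t Bt ht] := @count_family3 22 2 k B count3_22 isT.
  exists (44 * t + 4)%N; split; [lia | | by rewrite sign_odd //=; lia].
  by move: ht; congr (counted (sol 3 _) _); lia.
Qed.

Theorem corollary1p10 :
  (inf_values f1 = intN0 /\ inf_values f2 = intN0 /\ inf_values f5 = intN0) /\
  inf_values f6 = intoppN0 /\
  (inf_values f4 = [set: int] /\ inf_values f7 = [set: int]) /\
  (inf_values f3 = intN0 `|` intopp2N /\ inf_values f8 = intN0 `|` intopp2N).
Proof.
by rewrite f1_values f2_values f3_values f4_values f5_values f6_values f7_values f8_values.
Qed.
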